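(* Given $P_0,P_1\in\mathbb{S}^n_{++}$, the path $$P_t^{\rm info}=P_0^{1/2}\left(P_0^{-1/2}P_1P_0^{-1/2}\right)^tP_0^{1/2}$$ is the unique minimizer of $$\min_{P_t,A_t}\left\{\int_0^1 f_{P_t}^{{\rm info},1}(A_t)\,dt\;\Big|\;\dot P_t=A_tP_t+P_tA_t',\ P_0,P_1\text{ specified}\right\},$$ and the optimal $A_t$ is equal to the constant matrix $$A^{\rm info}=\tfrac12P_0^{1/2}\log\left(P_0^{-1/2}P_1P_0^{-1/2}\right)P_0^{-1/2}.$$ Moreover, the optimal value of the objective function is equal to $d_{\rm info}(P_0,P_1)^2$, where $d_{\rm info}(P_0,P_1)=\left\|\log\left(P_0^{-1/2}P_1P_0^{-1/2}\right)\right\|_{\rm F}$.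
   Context: $\mathbb{S}^n_{++}$ is the set of real symmetric positive definite $n\times n$ matrices; $'$ denotes transpose; $P^{1/2}$ is the unique positive definite square root of $P$; $\log$ and real powers of positive definite matrices are the usual (spectral) ones; $\|\cdot\|_{\rm F}$ is the Frobenius norm. For $P\in\mathbb{S}^n_{++}$ and a symmetric matrix $\Delta$, the Fisher-Rao metric for zero-mean Gaussian distributions with covariance $P$ is $g_{P,{\rm Rao}}(\Delta)=\operatorname{tr}(P^{-1}\Delta P^{-1}\Delta)$. For $P\in\mathbb{S}^n_{++}$ and $A\in\mathbb{R}^{n\times n}$, $$f_P^{{\rm info},1}(A)=g_{P,{\rm Rao}}(AP+PA')=2\operatorname{tr}\left(AA+P^{-1}APA'\right).$$ The minimization is over paths of covariance matrices $P_t\in\mathbb{S}^n_{++}$ and system matrices $A_t\in\mathbb{R}^{n\times n}$, $t\in[0,1]$, satisfying the stated differential equation, where $P_t$ takes the prescribed values $P_0$ at $t=0$ and $P_1$ at $t=1$.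
   Formalization: The optimal A_t is not unique for n ≥ 2 (P_0=P_1=I: any antisymmetric A_t has cost 0); the formal claim is that A^info is optimal and each optimal A_t has A_tP_t+P_tA_t' = A^infoP_t+P_tA^info' for a.e. t. *)

(* Defs.v *)
From HB Require Import structures.
From mathcomp Require Import all_boot all_order all_algebra.
From mathcomp Require Import all_classical all_reals all_analysis.
Import Order.TTheory GRing.Theory Num.Theory.
Import numFieldNormedType.Exports.
Set Implicit Arguments.
Unset Strict Implicit.
Unset Printing Implicit Defensive.
Local Open Scope classical_set_scope.
Local Open Scope ring_scope.

Definition spd (R : realType) (n : nat) (P : 'M[R]_n) : Prop :=
  P^T = P /\ forall x : 'cV[R]_n, x != 0 -> 0 < (x^T *m P *m x) 0 0.

Definition orthogonal_mx (R : realType) (n : nat) (Q : 'M[R]_n) : Prop :=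
  Q^T *m Q = 1%:M.

(* A symmetric S has an orthogonal diagonalization, and the resulting matrix
   does not depend on which one is chosen; when S has none (S not symmetric)
   the value is the junk matrix 0. *)
Definition spectral_fun (R : realType) (n : nat) (phi : R -> R) (S : 'M[R]_n) :
    'M[R]_n :=
  xget 0 [set X | exists (Q : 'M[R]_n) (d : 'rV[R]_n),
    [/\ orthogonal_mx Q, S = Q *m diag_mx d *m Q^T &
        X = Q *m diag_mx (map_mx phi d) *m Q^T]].

Definition mxlog (R : realType) (n : nat) (P : 'M[R]_n) : 'M[R]_n :=
  spectral_fun (@ln R) P.

Definition mxpow (R : realType) (n : nat) (P : 'M[R]_n) (t : R) : 'M[R]_n :=
  spectral_fun (fun x => x `^ t) P.

Definition mxsqrt (R : realType) (n : nat) (P : 'M[R]_n) : 'M[R]_n :=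
  xget 0 [set S | spd S /\ S *m S = P].

(* The library norm on matrices is the max norm, hence this definition. *)
Definition frobenius_norm (R : realType) (n : nat) (A : 'M[R]_n) : R :=
  Num.sqrt (\sum_(i < n) \sum_(j < n) A i j ^+ 2).

Definition g_Rao (R : realType) (n : nat) (P D : 'M[R]_n) : R :=
  \tr (invmx P *m D *m invmx P *m D).

Definition f_info (R : realType) (n : nat) (P A : 'M[R]_n) : R :=
  g_Rao P (A *m P + P *m A^T).

Definition absolutely_continuous (R : realType) (V : normedModType R) (a b : R)
    (f : R -> V) : Prop :=
  forall e : R, 0 < e -> exists2 d : R, 0 < d &
    forall (k : nat) (u v : 'I_k -> R),
      (forall i, a <= u i /\ u i <= v i /\ v i <= b) ->
      (forall i j, i != j -> v i <= u j \/ v j <= u i) ->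
      \sum_(i < k) (v i - u i) < d ->
      \sum_(i < k) `|f (v i) - f (u i)| < e.

(* Admissible paths are taken in the Caratheodory sense: t |-> P t is absolutely
   continuous on [0, 1] and the differential equation holds at almost every t.
   Values outside [0, 1] are irrelevant. *)
Definition feasible (R : realType) (n : nat) (P0 P1 : 'M[R]_n)
    (P A : R -> 'M[R]_n) : Prop :=
  [/\ forall t : R, 0 <= t <= 1 -> spd (P t),
      P 0 = P0 /\ P 1 = P1,
      absolutely_continuous 0 1 P,
      forall i j : 'I_n, measurable_fun (`[0, 1] : set R) (fun t : R => A t i j : R) &
      {ae @lebesgue_measure R, forall t : R, 0 <= t <= 1 ->
        is_derive t 1 P (A t *m P t + P t *m (A t)^T)}].

(* On admissible pairs the integrand is measurable and nonnegative, so the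
   integral is well defined in [0, +oo]. *)
Definition cost (R : realType) (n : nat) (P A : R -> 'M[R]_n) : \bar R :=
  (\int[@lebesgue_measure R]_(t in `[0%R, 1%R]) (f_info (P t) (A t))%:E)%E.

Definition minimizer (R : realType) (n : nat) (P0 P1 : 'M[R]_n)
    (P A : R -> 'M[R]_n) : Prop :=
  feasible P0 P1 P A /\
  forall P' A' : R -> 'M[R]_n, feasible P0 P1 P' A' -> (cost P A <= cost P' A')%E.

Definition optimal_value (R : realType) (n : nat) (P0 P1 : 'M[R]_n) : \bar R :=
  ereal_inf [set c | exists P A : R -> 'M[R]_n,
    feasible P0 P1 P A /\ c = cost P A].

(* P0^{-1/2} P1 P0^{-1/2} *)
Definition whitened (R : realType) (n : nat) (P0 P1 : 'M[R]_n) : 'M[R]_n :=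
  invmx (mxsqrt P0) *m P1 *m invmx (mxsqrt P0).

Definition P_info (R : realType) (n : nat) (P0 P1 : 'M[R]_n) (t : R) : 'M[R]_n :=
  mxsqrt P0 *m mxpow (whitened P0 P1) t *m mxsqrt P0.

Definition A_info (R : realType) (n : nat) (P0 P1 : 'M[R]_n) : 'M[R]_n :=
  2^-1 *: (mxsqrt P0 *m mxlog (whitened P0 P1) *m invmx (mxsqrt P0)).

Definition d_info (R : realType) (n : nat) (P0 P1 : 'M[R]_n) : R :=
  frobenius_norm (mxlog (whitened P0 P1)).

(* Main.v *)
Require Import Defs.
From HB Require Import structures.
From mathcomp Require Import all_boot all_order all_algebra.
From mathcomp Require Import all_classical all_reals all_analysis.
From mathcomp Require Import measurable_realfun ring lra complex.
Import Order.TTheory GRing.Theory Num.Theory.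
Import numFieldNormedType.Exports.
Local Open Scope classical_set_scope.
Local Open Scope ring_scope.

(* The Fisher-Rao metric is invariant under the congruences P |-> K P K^T, so
   one may assume P0 = 1 and P1 = diag(d). Eliminating the first coordinate,
   with a the corner of P, b the column below it, S the Schur complement and
   c = b / a, gives
     g_P(P') = (a' / a)^2 + 2 a (c'^T S^-1 c') + g_S(S'),
   a sum of nonnegative terms. By Cauchy-Schwarz the first integrates to at
   least (ln d_0)^2, with equality only if ln a is affine in t, and induction on
   the dimension applies to S. Hence the cost is at least the sum of the
   (ln d_i)^2; in case of equality c' = 0 almost everywhere, so c stays at 0 and
   P_t = diag(d_i^t). *)

(** * Absolutely continuous functions on the unit interval *)

Section AbsCont.
Variable R : realType.
Local Notation mu := (@lebesgue_measure R).

(** Admissible paths are only absolutely continuous and satisfy the differential equation almost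
    everywhere, with [A] merely measurable. Endpoint values are therefore linked to integrals of
    derivatives through the Lebesgue form of the fundamental theorem of calculus, proved by a Cousin
    covering argument. Elimination stays inside this class of paths: the entries of the Schur
    complement are rational in those of [P], so closure under sums, products and reciprocals
    suffices, and no eigenvalue of [P t] has to be followed along the path. It also keeps the
    boundary data in normal form, since the Schur complement of the identity, or of a diagonal
    matrix, is again of that kind. The integrand depends on [A] only through the velocity
    [A P + P A^T], so the induction is on pairs of a path and its velocity; an optimal [A] is
    determined up to the kernel of this map, the matrices with [A P] antisymmetric. *)

Lemma cousin_induction (G : R -> Prop) (b : R) : 0 <= b -> G 0 ->
  (forall c, 0 <= c <= b -> exists2 r, 0 < r &
    forall x y, 0 <= x -> y <= b -> x <= c <= y -> c - r < x -> y < c + r ->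
      G x -> G y) ->
  G b.
Proof.
move=> b0 G0 step; pose S := [set x | 0 <= x <= b /\ G x].
have S0 : S 0 by split; rewrite // lexx b0.
have ubS : ubound S b by move=> x [/andP[]].
have supS : has_sup S by split; [exists 0|exists b].
pose c := sup S.
have c0 : 0 <= c by apply: ub_le_sup => //; exact: supS.2.
have cb : c <= b by apply: ge_sup => //; exact: supS.1.
have [|r r0 stepc] := step c; first by rewrite c0 cb.
(* The step at [c] is used twice: from a point just below [c] it reaches [c], and from [c] it passes
   beyond, which contradicts the supremum unless [c = b]. *)
have [x [/andP[x0 xb] Gx] cx] := sup_adherent r0 supS.
have xc : x <= c by apply: ub_le_sup; [exact: supS.2|split; rewrite // x0 xb].
have Gc : G c by apply: (stepc x) => //; rewrite ?xc ?lexx// ltrDl.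
have [->//|cneb] := eqVneq b c.
have cltb : c < b by rewrite lt_neqAle eq_sym cneb.
pose y := Num.min b (c + r / 2).
have cy : c < y by rewrite lt_min cltb/= ltrDl divr_gt0.
have Gy : G y.
  apply: (stepc c) => //; rewrite ?lexx ?(ltW cy)//.
  - by rewrite ge_min lexx.
  - by rewrite ltrBlDr ltrDl.
  - by rewrite gt_min ltrD2l ltr_pdivrMr// ltr_pMr ?ltr1n// orbT.
have : y <= c.
  apply: ub_le_sup; [exact: supS.2|split=> //].
  by rewrite (le_trans c0 (ltW cy))/= ge_min lexx.
by rewrite leNgt cy.
Qed.

(** The closure properties (sums, products, reciprocals, logarithms, matrix entries) all reduce to
    this domination of increments; a single dominating function is passed twice. *)
Lemma absolutely_continuous_le (V1 V2 V3 : normedModType R) (a b C : R)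
    (f : R -> V1) (g : R -> V2) (h : R -> V3) :
  0 <= C -> absolutely_continuous a b f -> absolutely_continuous a b g ->
  (forall u v, a <= u -> u <= v -> v <= b ->
    `|h v - h u| <= C * (`|f v - f u| + `|g v - g u|)) ->
  absolutely_continuous a b h.
Proof.
move=> C0 acf acg hfg e e0.
(* [C + 1] avoids a division by zero when [C = 0]; the factor 2 shares [e] between [f] and [g]. *)
pose e' := e / ((C + 1) * 2).
have e'0 : 0 < e' by rewrite divr_gt0// mulr_gt0// ltr_wpDl.
have [df df0 Hf] := acf _ e'0; have [dg dg0 Hg] := acg _ e'0.
exists (Num.min df dg) => [|k u v uv dis]; first by rewrite lt_min df0.
rewrite lt_min => /andP[sf sg].
have {}Hf := Hf k u v uv dis sf; have {}Hg := Hg k u v uv dis sg.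
apply: (@le_lt_trans _ _ (C * (\sum_(i < k) `|f (v i) - f (u i)| +
                          \sum_(i < k) `|g (v i) - g (u i)|))).
  rewrite -big_split mulr_sumr; apply: ler_sum => i _.
  by have [? [? ?]] := uv i; exact: hfg.
have -> : e = (C + 1) * (e' + e').
  rewrite /e'; field; lra.
apply: (@le_lt_trans _ _ (C * (e' + e'))).
  by rewrite ler_wpM2l// lerD// ltW.
by rewrite ltr_pM2r ?addr_gt0// ltrDl.
Qed.

Lemma absolutely_continuous_lipschitz (V : normedModType R) (a b C : R)
    (f : R -> V) : 0 <= C ->
  (forall u v, a <= u -> u <= v -> v <= b -> `|f v - f u| <= C * (v - u)) ->
  absolutely_continuous a b f.
Proof.
move=> C0 lipf e e0; exists (e / (C + 1)) => [|k u v uv _ suv].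
  by rewrite divr_gt0// ltr_wpDl.
apply: (@le_lt_trans _ _ (C * \sum_(i < k) (v i - u i))).
  rewrite mulr_sumr; apply: ler_sum => i _.
  by have [? [? ?]] := uv i; exact: lipf.
have s0 : 0 <= \sum_(i < k) (v i - u i).
  by rewrite sumr_ge0// => i _; rewrite subr_ge0; have [? []] := uv i.
move: suv; rewrite ltr_pdivlMr ?ltr_wpDl// => h; apply: le_lt_trans h.
by rewrite mulrDr mulr1 mulrC lerDl.
Qed.

(** A list can grow during a Cousin induction. New intervals are added at the head, hence the order
    from right to left. *)
Lemma absolutely_continuous_seq (V : normedModType R) (a b : R) (f : R -> V) :
  absolutely_continuous a b f ->
  forall e : R, 0 < e -> exists2 d : R, 0 < d & forall s : seq (R * R),
    all (fun p => [&& a <= p.1, p.1 <= p.2 & p.2 <= b]) s ->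
    pairwise (fun p q => q.2 <= p.1) s ->
    \sum_(p <- s) (p.2 - p.1) < d -> \sum_(p <- s) `|f p.2 - f p.1| < e.
Proof.
move=> acf e e0; have [d d0 H] := acf e e0; exists d => // s sab dis.
rewrite (big_nth 0) big_mkord => sd; rewrite (big_nth 0) big_mkord.
apply: (H _ (fun i : 'I_(size s) => (nth 0 s i).1) (fun i => (nth 0 s i).2)) => //.
  move=> i; have := allP sab _ (mem_nth 0 (ltn_ord i)).
  by move=> /and3P[].
move=> i j; rewrite neq_ltn => /orP[ij|ij].
  by right; apply: (pairwiseP 0 dis) => //; rewrite inE ltn_ord.
by left; apply: (pairwiseP 0 dis) => //; rewrite inE ltn_ord.
Qed.

Lemma absolutely_continuous_local (V : normedModType R) (a b : R) (f : R -> V) :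
  absolutely_continuous a b f ->
  forall e : R, 0 < e -> exists2 d : R, 0 < d & forall x y,
    a <= x <= b -> a <= y <= b -> `|y - x| < d -> `|f y - f x| < e.
Proof.
move=> acf e e0; have [d d0 H] := absolutely_continuous_seq _ _ _ _ acf e e0.
exists d => // x y; wlog xy : x y / x <= y.
  move=> h xab yab; have [xy|yx] := leP x y; first exact: h.
  by rewrite distrC [X in _ -> X < _]distrC; apply: h => //; exact: ltW.
move=> /andP[ax xb] /andP[ay yb]; rewrite ger0_norm ?subr_ge0// => yxd.
have := H [:: (x, y)]; rewrite !big_seq1/=; apply => //.
by rewrite ax xy yb.
Qed.

Lemma absolutely_continuous_bounded (V : normedModType R) (f : R -> V) :
  absolutely_continuous 0 1 f ->
  exists2 M : R, 0 < M & forall t, 0 <= t <= 1 -> `|f t| <= M.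
Proof.
move=> acf; have [d d0 H] := absolutely_continuous_local _ _ _ _ acf _ ltr01.
apply: (cousin_induction
  (fun x => exists2 M : R, 0 < M & forall t, 0 <= t <= x -> `|f t| <= M)) => //.
  exists (`|f 0| + 1); first by rewrite ltr_wpDl.
  by move=> t /andP[t0 t0']; have -> : t = 0; [lra|rewrite lerDl].
move=> c c01; exists d => // x y x0 y1 /andP[xc cy] cx yc [M M0 HM].
exists (M + (`|f c| + 1)); first by rewrite ltr_wpDr// addr_ge0.
move=> t /andP[t0 ty]; have [tx|xt] := leP t x.
  by apply: (le_trans (HM t _)); rewrite ?t0 ?tx// lerDl addr_ge0.
apply: ler_wpDl; first exact: ltW.
rewrite addrC -lerBlDr; apply: le_trans (lerB_dist _ _) _.
by apply/ltW/H => //; [lra|rewrite ltr_distl; lra].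
Qed.

(** Near [c] the function stays above [f c / 2], and Cousin induction makes such bounds uniform. The
    bound [m] is what makes the reciprocal and the logarithm Lipschitz on the range of [f]. *)
Lemma absolutely_continuous_gt0 (f : R -> R) :
  absolutely_continuous 0 1 f -> (forall t, 0 <= t <= 1 -> 0 < f t) ->
  exists2 m : R, 0 < m & forall t, 0 <= t <= 1 -> m <= f t.
Proof.
move=> acf f0.
apply: (cousin_induction
  (fun x => exists2 m : R, 0 < m & forall t, 0 <= t <= x -> m <= f t)) => //.
  exists (f 0); first by apply: f0; lra.
  by move=> t /andP[t0 t0']; have -> : t = 0 by lra.
move=> c c01; have fc0 := f0 c c01.
have fc2 : 0 < f c / 2 by rewrite divr_gt0.
have [d d0 H] := absolutely_continuous_local _ _ _ _ acf _ fc2.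
exists d => // x y x0 y1 /andP[xc cy] cx yc [m m0 Hm].
exists (Num.min m (f c / 2)); first by rewrite lt_min m0.
move=> t /andP[t0 ty]; have [tx|xt] := leP t x.
  by rewrite ge_min Hm// t0.
have : `|f t - f c| < f c / 2 by apply: H => //; [lra|rewrite ltr_distl; lra].
by rewrite ltr_distl ge_min => h; apply/orP; right; lra.
Qed.

Lemma absolutely_continuous_within (f : R -> R) :
  absolutely_continuous 0 1 f -> {within `[0, 1], continuous f}.
Proof.
move=> acf; apply/subspace_continuousP => x /=; rewrite in_itv/= => x01.
apply/cvgrPdist_lt => e e0.
have [d d0 H] := absolutely_continuous_local _ _ _ _ acf _ e0.
rewrite near_withinE; near=> y => /=; rewrite in_itv/= => y01.
rewrite distrC; apply: H => //; rewrite distrC.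
Unshelve. all: by end_near. Qed.

Lemma is_derive_local (f : R -> R) (x l : R) : is_derive x 1 f l ->
  forall e, 0 < e -> exists2 r, 0 < r & forall y, `|y - x| < r ->
    `|f y - f x - l * (y - x)| <= e * `|y - x|.
Proof.
move=> dfx e e0; have fxl : h^-1 *: (f (h *: 1 + x) - f x) @[h --> 0^'] --> l.
  have [dx <-] := dfx; exact: dx.
move/cvgrPdist_le : fxl => /(_ e e0)[/= r r0 Hr].
exists r => // y yxr; have [->|yx] := eqVneq y x.
  by rewrite !subrr mulr0 subrr !normr0 mulr0.
have yx0 : y - x != 0 by rewrite subr_eq0.
have := Hr (y - x); rewrite /= sub0r normrN => /(_ yxr yx0).
rewrite /GRing.scale/= mulr1 subrK => h.
have -> : f y - f x - l * (y - x) = (y - x) * - (l - (y - x)^-1 * (f y - f x)).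
  by field.
by rewrite normrM normrN mulrC ler_wpM2r.
Qed.

Lemma negligible_open_cover (N : set R) (e : R) :
  mu.-negligible N -> 0 < e ->
  exists U : set R, [/\ open U, N `<=` U & (mu U < e%:E)%E].
Proof.
move=> [A [mA A0 NA]] e0.
have [|U [oU AU Ue]] := lebesgue_regularity_outer mA _ e0.
  by rewrite [X in (X < _)%E]A0 ltry.
exists U; split => //; first exact: subset_trans AU.
have mU : measurable U by exact: open_measurable.
rewrite -(setDUK AU) measureU ?setDIK//; last exact: measurableD.
by rewrite [X in (X + _)%E]A0 add0e.
Qed.

(* Cousin's lemma splits [0, b] into intervals on which f minus the indefinite
   integral F of g is nearly constant, and intervals contained in an open set U
   of small measure, where absolute continuity bounds f and F separately. *)
Lemma absolutely_continuous_FTC (f g : R -> R) (b : R) :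
  absolutely_continuous 0 1 f -> mu.-integrable setT (EFin \o g) ->
  {ae mu, forall t : R, 0 <= t <= 1 -> is_derive t 1 f (g t)} ->
  0 <= b <= 1 -> f b - f 0 = \int[mu]_(t in `]0, b]) g t.
Proof.
move=> acf intg dfg /andP[b0 b1].
have intgS (D : set R) : measurable D -> mu.-integrable D (EFin \o g).
  by move=> mD; apply: (integrableS measurableT).
have intng (D : set R) : measurable D -> mu.-integrable D (EFin \o (Num.norm \o g)).
  by move=> mD; exact: (integrable_norm (intgS D mD)).
pose F x := \int[mu]_(t in `]-oo, x]) g t.
have FE x y : x <= y -> F y - F x = \int[mu]_(t in `]x, y]) g t.
  by move=> xy; rewrite /F Rintegral_itvB//; exact: intgS.
pose h x := f x - F x.
(* The term [e * b] comes from the intervals around points where [h] has derivative 0; on the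
   exceptional intervals one [e] pays for [f] and the other for [F]. *)
suff he e : 0 < e -> `|h b - h 0| <= e * b + (e + e).
  rewrite -FE//; have -> : f b - f 0 = F b - F 0 + (h b - h 0) by rewrite /h; ring.
  suff -> : h b - h 0 = 0 by rewrite addr0.
  apply/eqP; rewrite -normr_le0; apply/ler_addgt0Pr => e e0.
  rewrite add0r; have e'0 : 0 < e / (b + 2) by rewrite divr_gt0// ltr_wpDl.
  apply: le_trans (he _ e'0) _; rewrite le_eqVlt; apply/orP; left.
  by apply/eqP; field; lra.
have dF : {ae mu, forall x : R, derivable F x 1 /\ derive1 F x = g x}.
  apply: FTC1Ny => [y|]; first exact: intgS.
  by apply: open_integrable_locally => //; exact: openT.
have dh : {ae mu, forall t : R, 0 <= t <= 1 -> is_derive t 1 h 0}.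
  apply: (filterS2 (ae_filter_ringOfSetsType mu) _ dfg dF).
  move=> t dft [dFt Fgt] /dft {}dft.
  rewrite -(subrr (g t)); apply: is_deriveB; rewrite -Fgt derive1E.
  exact: derivableP.
move=> e0.
have [d1 d10 Hd1] := absolutely_continuous_seq _ _ _ _ acf e e0.
have [d2 [d20 Hd2]] := integral_normr_continuous intg e0.
have d0 : 0 < Num.min d1 d2 by rewrite lt_min d10.
have [U [oU NU Ud]] := negligible_open_cover _ _ dh d0.
have mU : measurable U by exact: open_measurable.
pose W x := U `&` `]0, x].
have mW x : measurable (W x) by exact: measurableI.
have WE x y : 0 <= x -> x <= y -> W y = W x `|` (U `&` `]x, y]).
  move=> x0 xy; rewrite /W -setIUr; congr (_ `&` _).
  by apply: itv_bndbnd_setU; rewrite bnd_simp.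
have Wdis x y : W x `&` (U `&` `]x, y]) = set0.
  apply/seteqP; split => // t [[_ /=]]; rewrite !in_itv/= => /andP[_ tx] [_].
  by rewrite ltNge tx.
have mWxy x y : measurable (U `&` `]x, y]) by exact: measurableI.
have muW x y : 0 <= x -> x <= y -> mu (W y) = (mu (W x) + mu (U `&` `]x, y]))%E.
  move=> x0 xy; rewrite (WE x y)// measureU//; [exact: mW|exact: mWxy].
pose I x := \int[mu]_(t in W x) `|g t|.
have IE x y : 0 <= x -> x <= y ->
    I y = I x + \int[mu]_(t in U `&` `]x, y]) `|g t|.
  move=> x0 xy; rewrite /I (WE x y)// Rintegral_setU//.
  - exact: mW.
  - exact: mWxy.
  - by apply: intng; exact: measurableU.
  - by apply/disj_set2P; exact: Wdis.
(* This is the invariant carried from [0] to [b]: [s] lists the steps taken inside [U]. Both its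
   total length and the increments of [F] on it are charged to the part of [U] below the current
   point, which is additive in that point. *)
have [s [s0b sdis sW hb]] : exists s : seq (R * R),
    [/\ all (fun p => [&& 0 <= p.1, p.1 <= p.2 & p.2 <= b]) s,
        pairwise (fun p q => q.2 <= p.1) s,
        ((\sum_(p <- s) (p.2 - p.1))%:E <= mu (W b))%E &
        `|h b - h 0| <= e * b + (\sum_(p <- s) `|f p.2 - f p.1| + I b)].
  apply: (cousin_induction (fun x => exists s : seq (R * R),
    [/\ all (fun p => [&& 0 <= p.1, p.1 <= p.2 & p.2 <= x]) s,
        pairwise (fun p q => q.2 <= p.1) s,
        ((\sum_(p <- s) (p.2 - p.1))%:E <= mu (W x))%E &
        `|h x - h 0| <= e * x + (\sum_(p <- s) `|f p.2 - f p.1| + I x)])) => //.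
    exists [::]; split => //; first by rewrite big_nil measure_ge0.
    by rewrite subrr normr0 mulr0 big_nil !add0r; exact: Rintegral_ge0.
  move=> c /andP[c0 cb].
  have [Uc|nUc] := pselect (U c).
    have [r /= r0 rU] := oU c Uc.
    exists r => // x y x0 yb /andP[xc cy] cx yc [s [sx sdis sW hx]].
    have xy : x <= y by exact: le_trans cy.
    have xyU : `]x, y] `<=` U.
      move=> t; rewrite /= in_itv/= => /andP[xt ty]; apply: rU.
      by rewrite /ball/= ltr_distl; lra.
    exists ((x, y) :: s); split.
    - rewrite /= x0 xy lexx/=; apply: sub_all sx => p /and3P[-> ->] /= px.
      exact: le_trans xy.
    - rewrite pairwise_cons sdis andbT; apply: sub_all sx => p /and3P[_ _] //.
    - rewrite big_cons/= EFinD (muW x y)// addeC leeD// (setIidr xyU).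
      rewrite lebesgue_measure_itv/= lte_fin; case: ltP => // yx.
      by rewrite lee_fin subr_le0.
    rewrite big_cons/= (IE x y)// (setIidr xyU).
    have -> : h y - h 0 = (h x - h 0) + ((f y - f x) - (F y - F x)).
      by rewrite /h; ring.
    apply: le_trans (ler_normD _ _) _; apply: le_trans (lerD hx (ler_normB _ _)) _.
    have FJ : `|F y - F x| <= \int[mu]_(t in `]x, y]) `|g t|.
      by rewrite FE// le_normr_Rintegral//; exact: intgS.
    rewrite [leRHS](_ : _ = e * y + (\sum_(p <- s) `|f p.2 - f p.1| + I x) +
      (`|f y - f x| + \int[mu]_(t in `]x, y]) `|g t|)); last by ring.
    by rewrite lerD ?lerD// ler_wpM2l// ltW.
  have dhc : is_derive c 1 h 0.
    apply: contrapT => ndhc; apply: nUc; apply: NU => /= H; apply: ndhc.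
    by apply: H; rewrite c0 (le_trans cb).
  have [r r0 Hr] := is_derive_local _ _ _ dhc _ e0.
  exists r => // x y x0 yb /andP[xc cy] cx yc [s [sx sdis sW hx]].
  have xy : x <= y by exact: le_trans cy.
  exists s; split => //.
  - by apply: sub_all sx => p /and3P[-> ->] /= px; exact: le_trans xy.
  - by apply: le_trans sW _; rewrite (muW x y)// leeDl.
  (* Since [x <= c <= y], the errors at [x] and at [y] add up to exactly [e * (y - x)]. *)
  have /Hr : `|y - c| < r by rewrite ltr_distl; lra.
  rewrite mul0r subr0 [X in _ <= _ * X]ger0_norm ?subr_ge0// => hy.
  have /Hr : `|x - c| < r by rewrite ltr_distl; lra.
  rewrite mul0r subr0 [X in _ <= _ * X]ler0_norm ?subr_le0// => hx'.
  have -> : h y - h 0 = (h x - h 0) + ((h y - h c) - (h x - h c)) by ring.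
  apply: le_trans (ler_normD _ _) _; apply: le_trans (lerD hx (ler_normB _ _)) _.
  rewrite (IE x y)//.
  have J0 : 0 <= \int[mu]_(t in U `&` `]x, y]) `|g t| by exact: Rintegral_ge0.
  rewrite [leRHS](_ : _ = e * x + (\sum_(p <- s) `|f p.2 - f p.1| + I x) +
    (e * (y - c) + e * - (x - c) + \int[mu]_(t in U `&` `]x, y]) `|g t|));
    last by ring.
  by rewrite lerD2l; apply: le_trans (lerD hy hx') _; rewrite lerDl.
have muWU : (mu (W b) <= mu U)%E.
  by apply: le_measure; rewrite ?inE; [exact: mW|exact: mU|exact: subIsetl].
apply: le_trans hb _; rewrite lerD2l lerD//.
  apply/ltW/Hd1 => //.
    by apply: sub_all s0b => p /and3P[-> ->] /= pb; exact: le_trans b1.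
  rewrite -lte_fin; apply: le_lt_trans sW _.
  apply: (@le_lt_trans _ _ (mu U)); first exact: muWU.
  by apply: lt_le_trans Ud _; rewrite lee_fin ge_min lexx.
apply/ltW/Hd2; first exact: mW.
apply: (@le_lt_trans _ _ (mu U)); first exact: muWU.
by apply: lt_le_trans Ud _; rewrite lee_fin ge_min lexx orbT.
Qed.

(** * Energy of real functions on the unit interval *)

Lemma lebesgue_measure_unit_itv : mu (`[0, 1] : set R) = 1%E.
Proof. by rewrite lebesgue_measure_itv/= lte_fin ltr01 sube0. Qed.

Lemma measurable_unit_itv : (R.-ocitv.-measurable).-sigma.-measurable `[0 : R, 1 : R]%classic.
Proof. exact: measurable_itv. Qed.

Lemma integrable_unit_itv_cst (k : R) : mu.-integrable `[0, 1] (EFin \o cst k).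
Proof.
apply: measurable_bounded_integrable => //.
  by rewrite [X in (X < _)%E]lebesgue_measure_unit_itv ltry.
by exists `|k|; split; rewrite ?num_real// => x kx t _ /=; exact: ltW.
Qed.

(** Expanding [(|g| - 1)^2 >= 0] gives [|g| <= 1 + g^2], and constants are integrable on an interval
    of length 1. *)
Lemma integrable_of_sqr (g : R -> R) : measurable_fun (`[0, 1] : set R) g ->
  (\int[mu]_(t in `[0%R, 1%R]) (g t ^+ 2)%:E < +oo)%E ->
  mu.-integrable `[0, 1] (EFin \o (fun t => g t ^+ 2)) /\
  mu.-integrable `[0, 1] (EFin \o g).
Proof.
move=> mg goo.
have int2 : mu.-integrable `[0, 1] (EFin \o (fun t => g t ^+ 2)).
  apply/integrableP; split.
    by apply/measurable_EFinP; exact: measurable_funX.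
  under eq_integral do rewrite /= ger0_norm ?sqr_ge0//.
  exact: goo.
split => //.
apply: (le_integrable _ _ _ (integrableD _ (integrable_unit_itv_cst 1) int2)) => //.
  exact/measurable_EFinP.
move=> t _; rewrite /= lee_fin [leRHS]ger0_norm ?addr_ge0 ?sqr_ge0//.
have : 0 <= (`|g t| - 1) ^+ 2 by exact: sqr_ge0.
by rewrite -(real_normK (num_real (g t))) sqrrB1; nra.
Qed.

(** This is the variance identity for the uniform law on the unit interval. Nonnegativity of the
    variance is Cauchy-Schwarz, and its vanishing is the equality case. *)
Lemma Rintegral_sqr_subr (g : R -> R) (c : R) :
  measurable_fun (`[0, 1] : set R) g ->
  (\int[mu]_(t in `[0%R, 1%R]) (g t ^+ 2)%:E < +oo)%E ->
  \int[mu]_(t in `[0, 1]) g t = c ->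
  mu.-integrable `[0, 1] (EFin \o (fun t => (g t - c) ^+ 2)) /\
  \int[mu]_(t in `[0, 1]) ((g t - c) ^+ 2) =
  \int[mu]_(t in `[0, 1]) (g t ^+ 2) - c ^+ 2.
Proof.
move=> mg goo gc; have [int2 int1] := integrable_of_sqr _ mg goo.
have mI := measurable_unit_itv.
have intZ : mu.-integrable `[0, 1] (EFin \o (fun t => - (2 * c) * g t)).
  exact: (integrableZl mI (- (2 * c)) int1).
have intc := integrable_unit_itv_cst (c ^+ 2).
have -> : (fun t => (g t - c) ^+ 2) =
          (fun t => g t ^+ 2 + (- (2 * c) * g t + c ^+ 2)).
  by apply/funext => t; ring.
have intZc := integrableD mI intZ intc.
split; first exact: (integrableD mI int2 intZc).
rewrite RintegralD// RintegralD// RintegralZl// gc Rintegral_cst//.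
have -> : fine (mu `[0, 1]) = 1 by rewrite lebesgue_measure_unit_itv.
by ring.
Qed.

Lemma absolutely_continuous_FTC_itv (f g : R -> R) : absolutely_continuous 0 1 f ->
  mu.-integrable `[0, 1] (EFin \o g) ->
  {ae mu, forall t : R, 0 <= t <= 1 -> is_derive t 1 f (g t)} ->
  f 1 - f 0 = \int[mu]_(t in `[0, 1]) g t.
Proof.
move=> acf intg dfg.
have mI := measurable_unit_itv.
have intg' : mu.-integrable setT (EFin \o (g \_ `[0, 1])).
  by rewrite -restrict_EFin; apply/integrable_restrict => //=; rewrite setTI.
rewrite (absolutely_continuous_FTC f _ 1 acf intg'); last first.
- by rewrite ler01 lexx.
- apply: filterS dfg; first exact: (ae_filter_ringOfSetsType mu).
  move=> t dft t01.
  by rewrite patchE mem_set//; exact: dft.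
rewrite Rintegral_itv_obnd_cbnd; last exact: (integrableS measurableT).
by apply: eq_Rintegral => t tI; rewrite patchE tI.
Qed.

Lemma absolutely_continuous_affine (f : R -> R) (c : R) :
  absolutely_continuous 0 1 f ->
  {ae mu, forall t : R, 0 <= t <= 1 -> is_derive t 1 f c} ->
  forall t, 0 <= t <= 1 -> f t = f 0 + t * c.
Proof.
move=> acf dfc b b01.
have intc : mu.-integrable setT (EFin \o (cst c \_ `[0, 1])).
  rewrite -restrict_EFin; apply/integrable_restrict => //=; rewrite setTI.
  exact: integrable_unit_itv_cst.
apply/eqP; rewrite addrC -subr_eq; apply/eqP.
rewrite (absolutely_continuous_FTC f _ b acf intc _ b01); last first.
  apply: filterS dfc; first exact: (ae_filter_ringOfSetsType mu).
  by move=> t dft t01; rewrite patchE mem_set//; exact: dft.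
move/andP: b01 => [b0 b1].
rewrite (@eq_Rintegral _ _ _ _ _ (cst c)); last first.
  move=> t; rewrite inE/= in_itv/= => /andP[t0 tb]; rewrite patchE mem_set//=.
  by rewrite in_itv/= (ltW t0) (le_trans tb).
have mub : mu (`]0, b] : set R) = b%:E.
  rewrite lebesgue_measure_itv/= lte_fin; case: ltP => [_|b0'].
    by rewrite sube0.
  by congr EFin; apply/le_anti; rewrite b0 b0'.
rewrite Rintegral_cst//; have -> : fine (mu `]0, b]) = b by rewrite mub.
by rewrite mulrC.
Qed.

Lemma energy_lower_bound (f g : R -> R) : absolutely_continuous 0 1 f ->
  measurable_fun (`[0, 1] : set R) g ->
  {ae mu, forall t : R, 0 <= t <= 1 -> is_derive t 1 f (g t)} ->
  (((f 1 - f 0) ^+ 2)%:E <= \int[mu]_(t in `[0%R, 1%R]) (g t ^+ 2)%:E)%E.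
Proof.
move=> acf mg dfg.
(* An infinite energy makes the bound trivial; a finite one makes [g] integrable, as the fundamental
   theorem requires. *)
have [goo|] := ltP (\int[mu]_(t in `[0%R, 1%R]) (g t ^+ 2)%:E)%E +oo%E; last first.
  by rewrite leye_eq => /eqP ->; rewrite leey.
have [int2 int1] := integrable_of_sqr _ mg goo.
have gc := esym (absolutely_continuous_FTC_itv _ _ acf int1 dfg).
have [_] := Rintegral_sqr_subr _ _ mg goo gc; move: (f 1 - f 0) => c h.
have mI := measurable_unit_itv.
rewrite -[leRHS]fineK ?lee_fin; last exact: integrable_fin_num int2.
rewrite -subr_ge0 -[X in 0 <= X]h.
by apply: Rintegral_ge0 => t _; exact: sqr_ge0.
Qed.

(** Equality means zero variance, so [g] is almost everywhere equal to its mean [f 1 - f 0], and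
    absolute continuity integrates this to an affine [f]. *)
Lemma energy_lower_bound_eq (f g : R -> R) : absolutely_continuous 0 1 f ->
  measurable_fun (`[0, 1] : set R) g ->
  {ae mu, forall t : R, 0 <= t <= 1 -> is_derive t 1 f (g t)} ->
  (\int[mu]_(t in `[0%R, 1%R]) (g t ^+ 2)%:E <= ((f 1 - f 0) ^+ 2)%:E)%E ->
  forall t, 0 <= t <= 1 -> f t = f 0 + t * (f 1 - f 0).
Proof.
move=> acf mg dfg gle.
have goo : (\int[mu]_(t in `[0%R, 1%R]) (g t ^+ 2)%:E < +oo)%E.
  by apply: le_lt_trans gle _; rewrite ltry.
have [int2 int1] := integrable_of_sqr _ mg goo.
have gc := esym (absolutely_continuous_FTC_itv _ _ acf int1 dfg).
have := Rintegral_sqr_subr _ _ mg goo gc; move: (f 1 - f 0) gle gc => c gle gc.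
have mI := measurable_unit_itv.
move=> [intgc Igc].
have gc0 : (\int[mu]_(t in `[0%R, 1%R]) `|((g t - c) ^+ 2)%:E| = 0)%E.
  under eq_integral do rewrite /= ger0_norm ?sqr_ge0//.
  apply/eqP; rewrite eq_le integral_ge0 ?andbT; last first.
    by move=> t _; rewrite lee_fin sqr_ge0.
  rewrite -[leLHS](fineK (integrable_fin_num mI intgc)).
  move: gle; rewrite -[leLHS](fineK (integrable_fin_num mI int2)) !lee_fin => gle.
  by rewrite -/(Rintegral _ _ _) Igc subr_le0.
have mgc : measurable_fun (`[0, 1] : set R) (EFin \o (fun t => (g t - c) ^+ 2)).
  by apply/measurable_EFinP; apply: measurable_funX; exact: measurable_funB.
have [/(_ gc0) {}gc0 _] := ae_eq_integral_abs mu mI mgc.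
apply: absolutely_continuous_affine => //.
apply: (filterS2 (ae_filter_ringOfSetsType mu) _ dfg gc0) => t dft gtc t01.
have /eqP : ((g t - c) ^+ 2)%:E = 0%:E by apply: gtc; rewrite /= in_itv.
by rewrite eqe sqrf_eq0 subr_eq0 => /eqP <-; exact: dft.
Qed.

(** The derivative is carried as an explicit function, so that the closure lemmas below also yield
    the formulas for the velocity of the Schur complement. *)
Definition ac_derivative (f g : R -> R) : Prop :=
  absolutely_continuous 0 1 f /\
  {ae mu, forall t : R, 0 <= t <= 1 -> is_derive t 1 f (g t)}.

Lemma ac_derivative_ae (f g h k : R -> R) :
  {ae mu, forall t : R, 0 <= t <= 1 -> is_derive t 1 f (g t)} ->
  (forall t : R, 0 <= t <= 1 -> is_derive t 1 f (g t) -> is_derive t 1 h (k t)) ->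
  {ae mu, forall t : R, 0 <= t <= 1 -> is_derive t 1 h (k t)}.
Proof.
move=> dfg fh; apply: filterS dfg; first exact: (ae_filter_ringOfSetsType mu).
by move=> t dft t01; apply: fh (dft t01).
Qed.

Lemma ac_derivative_cst (c : R) : ac_derivative (cst c) (cst 0).
Proof.
split; last by apply: aeW => t _; exact: is_derive_cst.
apply: (absolutely_continuous_lipschitz _ _ _ 0) => // u v _ _ _.
by rewrite subrr normr0 mul0r.
Qed.

Lemma ac_derivativeD (f1 g1 f2 g2 : R -> R) :
  ac_derivative f1 g1 -> ac_derivative f2 g2 ->
  ac_derivative (fun t => f1 t + f2 t) (fun t => g1 t + g2 t).
Proof.
move=> [ac1 d1] [ac2 d2]; split.
  apply: (absolutely_continuous_le _ _ _ _ _ 1 _ _ _ _ ac1 ac2) => // u v _ _ _.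
  by rewrite mul1r opprD addrACA ler_normD.
apply: (filterS2 (ae_filter_ringOfSetsType mu) _ d1 d2) => t h1 h2 t01.
exact: is_deriveD (h1 t01) (h2 t01).
Qed.

Lemma ac_derivativeM (f1 g1 f2 g2 : R -> R) :
  ac_derivative f1 g1 -> ac_derivative f2 g2 ->
  ac_derivative (fun t => f1 t * f2 t) (fun t => g1 t * f2 t + f1 t * g2 t).
Proof.
move=> [ac1 d1] [ac2 d2]; split.
  have [M1 M10 b1] := absolutely_continuous_bounded _ _ ac1.
  have [M2 M20 b2] := absolutely_continuous_bounded _ _ ac2.
  have M0 : 0 <= M1 + M2 by rewrite addr_ge0 ?ltW.
  apply: (absolutely_continuous_le _ _ _ _ _ _ _ _ _ M0 ac1 ac2) => u v u0 uv v1.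
  have -> : f1 v * f2 v - f1 u * f2 u =
            f2 v * (f1 v - f1 u) + f1 u * (f2 v - f2 u) by ring.
  apply: le_trans (ler_normD _ _) _; rewrite !normrM mulrDr.
  have u01 : 0 <= u <= 1 by rewrite u0 (le_trans uv).
  have v01 : 0 <= v <= 1 by rewrite v1 (le_trans u0).
  apply: lerD; rewrite ler_wpM2r//.
    by rewrite ler_wpDl ?(ltW M10)// b2.
  by rewrite ler_wpDr ?(ltW M20)// b1.
apply: (filterS2 (ae_filter_ringOfSetsType mu) _ d1 d2) => t h1 h2 t01.
rewrite [X in is_derive _ _ _ X]addrC [g1 t * _]mulrC.
exact: is_deriveM (h1 t01) (h2 t01).
Qed.

Lemma ac_derivative_sum (I : Type) (r : seq I) (f g : I -> R -> R) :
  (forall i, ac_derivative (f i) (g i)) ->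
  ac_derivative (fun t => \sum_(i <- r) f i t) (fun t => \sum_(i <- r) g i t).
Proof.
move=> fg; elim: r => [|i r IHr].
  under eq_fun do rewrite big_nil; under [X in ac_derivative _ X]eq_fun do rewrite big_nil.
  exact: ac_derivative_cst.
under eq_fun do rewrite big_cons; under [X in ac_derivative _ X]eq_fun do rewrite big_cons.
exact: ac_derivativeD.
Qed.

Lemma ac_derivativeV (f g : R -> R) : ac_derivative f g ->
  (forall t, 0 <= t <= 1 -> 0 < f t) ->
  ac_derivative (fun t => (f t)^-1) (fun t => - (f t ^- 2 * g t)).
Proof.
move=> [acf dfg] f0; split.
  have [m m0 fm] := absolutely_continuous_gt0 _ acf f0.
  have C0 : 0 <= m^-1 ^+ 2 by exact: sqr_ge0.
  apply: (absolutely_continuous_le _ _ _ _ _ _ _ _ _ C0 acf acf) => u v u0 uv v1.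
  have u01 : 0 <= u <= 1 by rewrite u0 (le_trans uv).
  have v01 : 0 <= v <= 1 by rewrite v1 (le_trans u0).
  have fu := f0 _ u01; have fv := f0 _ v01.
  have -> : (f v)^-1 - (f u)^-1 = - ((f v)^-1 * (f u)^-1 * (f v - f u)).
    by field; rewrite !gt_eqF.
  rewrite normrN !normrM (gtr0_norm (x := _^-1)) ?invr_gt0//.
  rewrite (gtr0_norm (x := (f u)^-1)) ?invr_gt0//.
  have iu : (f u)^-1 <= m^-1 by rewrite lef_pV2 ?posrE// fm.
  have iv : (f v)^-1 <= m^-1 by rewrite lef_pV2 ?posrE// fm.
  apply: ler_pM => //; last by rewrite lerDl.
    by rewrite mulr_ge0 ?invr_ge0 ?ltW.
  by rewrite expr2 ler_pM ?invr_ge0 ?(ltW fv) ?(ltW fu).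
apply: ac_derivative_ae dfg _ => t t01 dft.
have := is_deriveV (lt0r_neq0 (f0 t t01)) dft.
by rewrite scaleNr.
Qed.

Lemma ac_derivative_ln (f g : R -> R) : ac_derivative f g ->
  (forall t, 0 <= t <= 1 -> 0 < f t) ->
  ac_derivative (fun t => ln (f t)) (fun t => g t / f t).
Proof.
move=> [acf dfg] f0; split.
  have [m m0 fm] := absolutely_continuous_gt0 _ acf f0.
  have C0 : 0 <= m^-1 by rewrite invr_ge0 ltW.
  (* This is [ln (1 + z) <= z] for [z = (y - x) / x]; exchanging [x] and [y] then bounds the
     absolute value. *)
  have ln_le x y : 0 < y -> m <= x -> ln y - ln x <= m^-1 * `|y - x|.
    move=> y0 mx; have x0 : 0 < x by exact: lt_le_trans mx.
    rewrite -ln_div ?posrE//; apply: le_trans (_ : (y - x) / x <= _).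
      have -> : y / x = 1 + (y - x) / x by field; rewrite gt_eqF.
      apply: le_ln1Dx; rewrite -subr_gt0 opprK.
      have -> : (y - x) / x + 1 = y / x by field; rewrite gt_eqF.
      by rewrite divr_gt0.
    rewrite mulrC; apply: le_trans (ler_norm _) _.
    rewrite normrM gtr0_norm ?invr_gt0// ler_wpM2r// lef_pV2 ?posrE//.
  apply: (absolutely_continuous_le _ _ _ _ _ _ _ _ _ C0 acf acf) => u v u0 uv v1.
  have u01 : 0 <= u <= 1 by rewrite u0 (le_trans uv).
  have v01 : 0 <= v <= 1 by rewrite v1 (le_trans u0).
  apply: (@le_trans _ _ (m^-1 * `|f v - f u|)); last first.
    by rewrite ler_wpM2l// lerDl.
  rewrite ler_norml lerNl opprB [in X in X && _]distrC.
  by rewrite !ln_le ?f0 ?fm.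
apply: ac_derivative_ae dfg _ => t t01 dft.
have := is_derive1_comp (is_derive1_ln (f0 t t01)) dft.
by rewrite mulrC.
Qed.

End AbsCont.

(** * Positive definite matrices *)

Section LinAlg.
Variable R : realType.

Lemma spd_unitmx n (P : 'M[R]_n) : spd P -> P \in unitmx.
Proof.
move=> [_ Ppos]; rewrite -row_free_unit -kermx_eq0; apply: contraT.
move=> /rowV0Pn[v /sub_kermxP vP v0].
have := Ppos v^T; rewrite trmxK vP mul0mx mxE ltxx.
by apply; rewrite -(inj_eq trmx_inj) trmxK trmx0.
Qed.

Lemma spd_congr n (K P : 'M[R]_n) : K \in unitmx -> spd P ->
  spd (K *m P *m K^T).
Proof.
move=> uK [symP posP]; split; first by rewrite !trmx_mul trmxK symP mulmxA.
move=> x x0.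
have -> : x^T *m (K *m P *m K^T) *m x = (K^T *m x)^T *m P *m (K^T *m x).
  by rewrite trmx_mul trmxK !mulmxA.
apply: posP.
apply: contra x0 => /eqP Kx0; have uKT : K^T \in unitmx by rewrite unitmx_tr.
by rewrite -(mulKmx uKT x) Kx0 mulmx0.
Qed.

Lemma mxtrace_mul_tr m n (X : 'M[R]_(m, n)) :
  \tr (X *m X^T) = \sum_i \sum_j X i j ^+ 2.
Proof.
by apply: eq_bigr => i _; rewrite mxE; apply: eq_bigr => j _; rewrite mxE expr2.
Qed.

Lemma mxtrace_mul_tr_ge0 m n (X : 'M[R]_(m, n)) : 0 <= \tr (X *m X^T).
Proof.
rewrite mxtrace_mul_tr sumr_ge0// => i _; rewrite sumr_ge0// => j _.
exact: sqr_ge0.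
Qed.

Lemma mxtrace_mul_tr_eq0 m n (X : 'M[R]_(m, n)) : \tr (X *m X^T) = 0 -> X = 0.
Proof.
rewrite mxtrace_mul_tr => X0; apply/matrixP => i j; rewrite [RHS]mxE.
have rowge0 k : 0 <= \sum_l X k l ^+ 2 by rewrite sumr_ge0// => l _; exact: sqr_ge0.
have Xi0 := psumr_eq0P (fun k (_ : true) => rowge0 k) X0.
have Xij0 := psumr_eq0P (fun l (_ : true) => sqr_ge0 (X i l)) (Xi0 i isT).
by apply/eqP; rewrite -sqrf_eq0 Xij0.
Qed.

Lemma g_Rao_congr n (K P D : 'M[R]_n) : K \in unitmx -> P \in unitmx ->
  g_Rao (K *m P *m K^T) (K *m D *m K^T) = g_Rao P D.
Proof.
move=> uK uP; have uKT : K^T \in unitmx by rewrite unitmx_tr.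
rewrite /g_Rao.
have -> : invmx (K *m P *m K^T) = invmx K^T *m invmx P *m invmx K.
  have uKPK : K *m P *m K^T \in unitmx by rewrite !unitmx_mul uK uP.
  rewrite -[RHS](mulKmx uKPK) -[LHS]mulmx1; congr (_ *m _).
  by rewrite -!mulmxA (mulKVmx uKT) (mulKVmx uP) mulmxV.
rewrite -!mulmxA !(mulKmx uK) (mulKVmx uKT) mxtrace_mulC -!mulmxA mulmxV//.
by rewrite mulmx1.
Qed.

(** * Spectral functions and diagonalization of symmetric matrices *)

Lemma orthogonal_mx_tr n (Q : 'M[R]_n) : orthogonal_mx Q -> Q *m Q^T = 1%:M.
Proof. exact: mulmx1C. Qed.

(** The matrix [T = Q'^T Q] intertwines the two diagonals: wherever [T i j] is nonzero,
    [d_j = d'_i], hence also [phi d_j = phi d'_i], and [T] intertwines the images under [phi]. *)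
Lemma spectral_fun_unique n (phi : R -> R) (Q Q' : 'M[R]_n) (d d' : 'rV[R]_n) :
  orthogonal_mx Q -> orthogonal_mx Q' ->
  Q *m diag_mx d *m Q^T = Q' *m diag_mx d' *m Q'^T ->
  Q *m diag_mx (map_mx phi d) *m Q^T = Q' *m diag_mx (map_mx phi d') *m Q'^T.
Proof.
move=> oQ oQ' eqQ.
have oQt := orthogonal_mx_tr _ _ oQ; have oQt' := orthogonal_mx_tr _ _ oQ'.
have [T TE] : exists T, T = Q'^T *m Q by eexists.
have Td : T *m diag_mx d = diag_mx d' *m T.
  rewrite -[LHS]mulmx1 -oQ TE !mulmxA -2!(mulmxA Q'^T) eqQ !mulmxA.
  by rewrite oQ' mul1mx.
have Tphi : T *m diag_mx (map_mx phi d) = diag_mx (map_mx phi d') *m T.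
  apply/matrixP => i j; have /matrixP/(_ i j) := Td.
  rewrite !mul_mx_diag !mul_diag_mx !mxE.
  have [->|Tij] := eqVneq (T i j) 0; first by rewrite !(mul0r, mulr0).
  by rewrite [T i j * d 0 j]mulrC => /(mulIf Tij) ->; rewrite mulrC.
have -> : Q *m diag_mx (map_mx phi d) = Q' *m (T *m diag_mx (map_mx phi d)).
  by rewrite TE !mulmxA oQt' mul1mx.
by rewrite Tphi TE -!mulmxA oQt mulmx1.
Qed.

Lemma spectral_funE n (phi : R -> R) (Q : 'M[R]_n) (d : 'rV[R]_n) :
  orthogonal_mx Q ->
  spectral_fun phi (Q *m diag_mx d *m Q^T) =
  Q *m diag_mx (map_mx phi d) *m Q^T.
Proof.
move=> oQ; rewrite /spectral_fun; case: xgetP => [X -> [Q' [d' [oQ' eqQ ->]]]|].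
  exact: spectral_fun_unique (esym eqQ).
by move=> /(_ (Q *m diag_mx (map_mx phi d) *m Q^T)); case; exists Q, d.
Qed.

(** The reflection in the hyperplane orthogonal to [v - e] exchanges the unit vectors [e] and [v];
    it will move an eigenvector to the first coordinate. *)
Lemma householder n (v : 'rV[R]_n.+1) : v *m v^T = 1%:M ->
  exists2 H : 'M[R]_n.+1, H *m H^T = 1%:M & delta_mx 0 0 *m H = v.
Proof.
move=> v1; pose e : 'rV[R]_n.+1 := delta_mx 0 0; pose w := v - e.
have e1 : e *m e^T = 1%:M.
  by rewrite /e trmx_delta mul_delta_mx; apply/matrixP => i j; rewrite !ord1 !mxE.
have ve : e *m v^T = v *m e^T.
  by rewrite -[LHS]trmxK trmx_mul trmxK [v *m e^T]mx11_scalar tr_scalar_mx.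
have [s ves] : exists s, v *m e^T = s%:M by eexists; exact: mx11_scalar.
have w2 : w *m w^T = (2 - 2 * s)%:M.
  rewrite /w raddfB/= mulmxBr !mulmxBl v1 e1 ve.
  by rewrite ves -!raddfB/=; congr (_%:M); ring.
have [w0|w0] := eqVneq w 0.
  exists 1%:M; first by rewrite mul1mx trmx1.
  by rewrite mulmx1; apply/esym/eqP; rewrite -subr_eq0; apply/eqP.
(* [c] is the squared length of [w], and [M] below is twice the orthogonal projection onto the line
   of [w], so [1 - M] is the reflection. *)
pose c := 2 - 2 * s.
have c0 : c != 0.
  apply: contra w0 => /eqP c0; rewrite (mxtrace_mul_tr_eq0 _ _ w)// w2 -/c.
  by rewrite c0 mxtrace_scalar mul0rn.
pose M : 'M[R]_n.+1 := (2 / c) *: (w^T *m w).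
have MT : M^T = M by rewrite /M linearZ/= trmx_mul trmxK.
have MM : M *m M = M + M.
  rewrite -scalemxAl -scalemxAr mulmxA -(mulmxA w^T) w2 -/c.
  rewrite mul_mx_scalar -scalemxAl -scalerDl !scalerA; congr (_ *: _).
  by field.
have ew : e *m w^T = (- (c / 2))%:M.
  rewrite /w [(v - e)^T]raddfB/= mulmxBr e1 ve.
  by rewrite ves -raddfB/=; congr (_%:M); rewrite /c; field.
have eM : e *m M = - w.
  rewrite -scalemxAr mulmxA ew.
  rewrite mul_scalar_mx scalerA mulrN scaleNr.
  have -> : 2 / c * (c / 2) = 1 by field.
  by rewrite scale1r.
exists (1%:M - M).
  by rewrite [(1%:M - M)^T]raddfB/= trmx1 MT mulmxBr mulmx1 mulmxBl mul1mx MM opprB addrK subrK.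
by rewrite mulmxBr mulmx1 -/e eM opprK /w addrC subrK.
Qed.


(** Take a complex eigenvector [x + i y] with eigenvalue [a + i b]. Computing [x A y^T] and its
    transpose [y A x^T] gives [b (|x|^2 + |y|^2) = 0], so [b = 0], and whichever of [x], [y] is
    nonzero is a real eigenvector. *)
Lemma symmetric_eigenvector n (A : 'M[R]_n.+1) : A^T = A ->
  exists a : R, exists2 v : 'rV[R]_n.+1, v *m v^T = 1%:M & v *m A = a *: v.
Proof.
move=> symA; pose rc := real_complex R.
have [c /eigenvalueP[v vA v0]] := eigenvalue_closed (map_mx rc A) (ltn0Sn n).
pose x := \row_j complex.Re (v 0 j); pose y := \row_j complex.Im (v 0 j).
have vE j : v 0 j = Complex (x 0 j) (y 0 j) by rewrite !mxE; case: (v 0 j).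
pose a := complex.Re c; pose b := complex.Im c.
have vAj j : \sum_k v 0 k * rc (A k j) = c * v 0 j.
  by have /rowP/(_ j) := vA; rewrite !mxE => <-; apply: eq_bigr => k _; rewrite mxE.
have sumE (F G : 'I_n.+1 -> R) : \sum_k Complex (F k) (G k) =
    Complex (\sum_k F k) (\sum_k G k).
  by elim/big_rec3 : _ => // k ? ? ? _ ->.
have vAE j : Complex ((x *m A) 0 j) ((y *m A) 0 j) =
    Complex (a * x 0 j - b * y 0 j) (a * y 0 j + b * x 0 j).
  rewrite !mxE -sumE [RHS](_ : _ = c * v 0 j); last first.
    by rewrite vE /a /b; case: (c) => c1 c2 /=; congr Complex; ring.
  rewrite -vAj; apply: eq_bigr => k _; by rewrite vE; simpc.
have xA : x *m A = a *: x - b *: y.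
  by apply/rowP => j; have [-> _] := vAE j; rewrite !mxE.
have yA : y *m A = a *: y + b *: x.
  by apply/rowP => j; have [_ ->] := vAE j; rewrite !mxE.
have xAy : x *m A *m y^T = (y *m A *m x^T)^T.
  by rewrite !trmx_mul trmxK symA mulmxA.
have b0 : b = 0.
  have /(congr1 mxtrace) := xAy; rewrite mxtrace_tr xA yA mulmxBl mulmxDl.
  rewrite raddfB raddfD/= -!scalemxAl !mxtraceZ.
  rewrite -[y *m x^T]trmxK mxtrace_tr trmx_mul trmxK.
  set X := \tr (y *m y^T); set Y := \tr (x *m x^T) => h.
  have X0 : 0 <= X := mxtrace_mul_tr_ge0 _ _ _.
  have Y0 : 0 <= Y := mxtrace_mul_tr_ge0 _ _ _.
  have : b * (X + Y) = 0 by lra.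
  move=> /eqP; rewrite mulf_eq0 => /orP[/eqP //|]; rewrite paddr_eq0//.
  move=> /andP[/eqP/mxtrace_mul_tr_eq0 y0 /eqP/mxtrace_mul_tr_eq0 x0].
  case/eqP: v0; apply/rowP => j.
  by rewrite vE x0 y0 !mxE.
have [u u0 uA] : exists2 u : 'rV[R]_n.+1, u != 0 & u *m A = a *: u.
  have [x0|x0] := eqVneq x 0; last by exists x; rewrite // xA b0 scale0r subr0.
  exists y; last by rewrite yA b0 scale0r addr0.
  apply: contra v0 => /eqP y0; apply/eqP/rowP => j.
  by rewrite vE x0 y0 !mxE.
exists a; pose t := \tr (u *m u^T); exists ((Num.sqrt t)^-1 *: u); last first.
  by rewrite -scalemxAl uA !scalerA mulrC.
have t0 : 0 < t.
  rewrite lt_def mxtrace_mul_tr_ge0 andbT; apply: contra u0 => /eqP t0.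
  by apply/eqP/mxtrace_mul_tr_eq0.
rewrite linearZ/= -scalemxAl -scalemxAr scalerA -invfM -expr2 sqr_sqrtr ?ltW//.
rewrite [u *m u^T]mx11_scalar -trace_mx11 -/t scale_scalar_mx mulVf//.
by rewrite gt_eqF.
Qed.

Lemma symmetric_diagonalization n (A : 'M[R]_n) : A^T = A ->
  exists Q d, orthogonal_mx Q /\ A = Q *m diag_mx d *m Q^T.
Proof.
elim: n A => [|n IHn] A symA.
  exists 0, 0; split; apply/matrixP => -[]//.
have [a [v v1 vA]] := symmetric_eigenvector _ _ symA.
have [H HH Hv] := householder _ _ v1.
have HtH : H^T *m H = 1%:M by exact: mulmx1C.
have symHAH : (H *m A *m H^T)^T = H *m A *m H^T.
  by rewrite !trmx_mul trmxK symA mulmxA.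
pose e : 'rV[R]_n.+1 := delta_mx 0 0.
have HAH0 : e *m (H *m A *m H^T) = a *: e.
  by rewrite !mulmxA Hv vA -scalemxAl -Hv -mulmxA HH mulmx1.
have AE : A = H^T *m (H *m A *m H^T) *m H.
  by rewrite !mulmxA HtH mul1mx -mulmxA HtH mulmx1.
move: (H *m A *m H^T : 'M[R]_(1 + n)) AE symHAH HAH0 => B AE symB B0.
(* The first row of [B] is [a e]; symmetry determines the first column too and leaves a symmetric
   block for the induction. *)
have BE : B = block_mx a%:M 0 0 (drsubmx B).
  have Br j : B 0 j = a * (j == 0)%:R.
    by have /rowP/(_ j) := B0; rewrite /e -rowE !mxE.
  have l0 : lshift n (0 : 'I_1) = 0 by exact: val_inj.
  have ul : ulsubmx B = a%:M.
    by apply/matrixP => i j; rewrite !ord1 2!mxE l0 Br !mxE mulr1n mulr1.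
  have ur : ursubmx B = 0.
    by apply/matrixP => i j; rewrite !ord1 2!mxE l0 Br mulr0 mxE.
  have dl : dlsubmx B = 0 by rewrite -symB -trmx_ursub ur trmx0.
  by rewrite -ul -[in LHS](submxK B) ur dl.
have symS : (drsubmx B)^T = drsubmx B by rewrite trmx_drsub symB.
have [Q [d [oQ SE]]] := IHn _ symS.
pose Q1 : 'M[R]_(1 + n) := block_mx 1%:M 0 0 Q.
have oQ1 : Q1^T *m Q1 = 1%:M.
  rewrite /Q1 tr_block_mx !trmx0 trmx1 mulmx_block !mulmx0 !mul0mx !mulmx1.
  by rewrite oQ !addr0 add0r -scalar_mx_block.
have BQ1 : B = Q1 *m diag_mx (row_mx a%:M d) *m Q1^T.
  rewrite [LHS]BE SE /Q1 diag_mx_row tr_block_mx !trmx0 trmx1 !mulmx_block.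
  rewrite !(mulmx0, mul0mx, mulmx1, mul1mx, addr0, add0r).
  by congr block_mx; apply/matrixP => i j; rewrite !ord1 !mxE.
exists (H^T *m Q1), (row_mx a%:M d); split.
  by rewrite /orthogonal_mx trmx_mul trmxK -mulmxA (mulmxA H) HH mul1mx.
by rewrite AE BQ1 trmx_mul trmxK !mulmxA.
Qed.

(** * Eigenvalues, square roots and elimination for positive definite matrices *)

Lemma orthogonal_mx_unit n (Q : 'M[R]_n) : orthogonal_mx Q -> Q \in unitmx.
Proof. by move=> /mulmx1_unit[]. Qed.

Lemma spd_diag_gt0 n (d : 'rV[R]_n) : spd (diag_mx d) -> forall i, 0 < d 0 i.
Proof.
move=> [_ dpos] i; have := dpos (delta_mx i 0).
rewrite trmx_delta -rowE -colE !mxE eqxx; apply.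
by apply/eqP => /matrixP/(_ i 0)/eqP; rewrite !mxE !eqxx oner_eq0.
Qed.

Lemma spd_diag n (d : 'rV[R]_n) : (forall i, 0 < d 0 i) -> spd (diag_mx d).
Proof.
move=> d0; split; first by rewrite tr_diag_mx.
move=> x x0; rewrite mul_mx_diag mxE lt_def.
have xx i : 0 <= d 0 i * x i 0 ^+ 2 by rewrite mulr_ge0 ?sqr_ge0 // ltW.
under eq_bigr do rewrite !mxE mulrC mulrA -expr2 mulrC.
rewrite sumr_ge0// andbT; apply: contra x0 => /eqP s0.
apply/eqP/colP => i; rewrite [RHS]mxE.
have di0 := psumr_eq0P (fun k (_ : true) => xx k) s0.
by have /eqP := di0 i isT; rewrite mulf_eq0 gt_eqF//= sqrf_eq0 => /eqP.
Qed.

Lemma spd_diagonalization n (P : 'M[R]_n) : spd P -> exists Q d,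
  [/\ orthogonal_mx Q, P = Q *m diag_mx d *m Q^T & forall i, 0 < d 0 i].
Proof.
move=> spdP; have [Q [d [oQ PE]]] := symmetric_diagonalization _ _ spdP.1.
exists Q, d; split=> //; apply: spd_diag_gt0.
have uQ := orthogonal_mx_unit _ _ oQ.
have -> : diag_mx d = Q^T *m P *m Q^T^T.
  by rewrite PE trmxK !mulmxA oQ mul1mx -mulmxA oQ mulmx1.
by apply: spd_congr; rewrite ?unitmx_tr.
Qed.

Lemma mxsqrtP n (P : 'M[R]_n) : spd P ->
  spd (mxsqrt P) /\ mxsqrt P *m mxsqrt P = P.
Proof.
move=> spdP; have [Q [d [oQ PE d0]]] := spd_diagonalization _ _ spdP.
rewrite /mxsqrt; case: xgetP => [X -> //|].
pose S := Q *m diag_mx (map_mx Num.sqrt d) *m Q^T.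
move=> /(_ S)[]; split.
  apply: spd_congr; first exact: orthogonal_mx_unit.
  by apply: spd_diag => i; rewrite mxE sqrtr_gt0.
rewrite /S PE -!mulmxA (mulmxA Q^T) oQ mul1mx; congr (_ *m _).
rewrite mulmxA; congr (_ *m _).
apply/matrixP => i j; rewrite mul_diag_mx !mxE.
by case: eqVneq => _; rewrite ?mulr0// !mulr1n -expr2 sqr_sqrtr// ltW.
Qed.

Lemma mx11_block_sym n (D : 'M[R]_(1 + n)) : D^T = D ->
  D = block_mx (D 0 0)%:M (dlsubmx D)^T (dlsubmx D) (drsubmx D).
Proof.
move=> symD; rewrite -[LHS]submxK trmx_dlsub symD; congr block_mx.
rewrite [LHS]mx11_scalar 2!mxE; congr (D _ _)%:M; exact: val_inj.
Qed.

(* Gaussian elimination of the first coordinate, as a congruence. *)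
Definition elim_mx n (c : 'cV[R]_n) : 'M[R]_(1 + n) :=
  block_mx 1%:M 0 (- c) 1%:M.

Lemma elim_mx_unit n (c : 'cV[R]_n) : elim_mx n c \in unitmx.
Proof. by rewrite unitmxE det_lblock !det1 mulr1 unitr1. Qed.

(** The column [c] is independent of [b] because the same elimination acts on two matrices: on [P],
    where [c = b / a] clears the off-diagonal blocks, and on the velocity, where something
    remains. *)
Lemma elim_mx_congr n (c b : 'cV[R]_n) (a : R) (C : 'M[R]_n) :
  elim_mx n c *m block_mx a%:M b^T b C *m (elim_mx n c)^T =
  block_mx a%:M (b - a *: c)^T (b - a *: c)
    (C - c *m b^T - b *m c^T + a *: (c *m c^T)).
Proof.
rewrite /elim_mx tr_block_mx !trmx1 trmx0 !mulmx_block.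
rewrite !(mul0mx, mulmx0, mul1mx, mulmx1, addr0, add0r, mulNmx).
congr block_mx.
- by rewrite raddfN/= mulmxN mul_scalar_mx [RHS]raddfB/= [(a *: c)^T]linearZ/= addrC.
- by rewrite mul_mx_scalar addrC.
rewrite raddfN/= mulmxN mulmxDl mulNmx mul_mx_scalar -scalemxAl.
move: (c *m c^T) (b *m c^T) (c *m b^T) => X Y Z.
by apply/matrixP => i j; rewrite !mxE; ring.
Qed.

Lemma spd_block n (a : R) (S : 'M[R]_n) :
  spd (block_mx a%:M 0 0 S : 'M[R]_(1 + n)) -> 0 < a /\ spd S.
Proof.
move=> [symB posB]; split.
  have := posB (col_mx 1%:M 0).
  rewrite tr_col_mx mul_row_block mul_row_col !(trmx1, trmx0).
  rewrite !(mul0mx, mulmx0, mul1mx, mulmx1, addr0, add0r) mxE eqxx; apply.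
  by rewrite col_mx_eq0 negb_and -scalemx1 scale1r matrix_nonzero1.
split.
  by move: symB; rewrite tr_block_mx => /eq_block_mx[].
move=> x x0; have := posB (col_mx 0 x).
rewrite tr_col_mx mul_row_block mul_row_col !(trmx1, trmx0).
rewrite !(mul0mx, mulmx0, mul1mx, mulmx1, addr0, add0r); apply.
by rewrite col_mx_eq0 negb_and x0 orbT.
Qed.

(** For [u = a c'] the middle term is [2 a (c'^T S^-1 c')]; the 2 counts the two off-diagonal
    blocks. *)
Lemma g_Rao_block n (a al : R) (u : 'cV[R]_n) (S T : 'M[R]_n) :
  a != 0 -> S \in unitmx ->
  g_Rao (block_mx a%:M 0 0 S : 'M[R]_(1 + n)) (block_mx al%:M u^T u T) =
  (al / a) ^+ 2 + 2 / a * \tr (u^T *m invmx S *m u) + g_Rao S T.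
Proof.
move=> a0 uS; rewrite /g_Rao.
have -> : invmx (block_mx a%:M 0 0 S : 'M[R]_(1 + n)) =
          block_mx (a^-1)%:M 0 0 (invmx S).
  set B := block_mx _ _ _ _; set B' := block_mx _ _ _ _.
  have BB' : B *m B' = 1%:M.
    rewrite mulmx_block !(mul0mx, mulmx0, addr0, add0r) mulmxV//.
    by rewrite -scalar_mxM mulfV// -scalar_mx_block.
  have [uB _] := mulmx1_unit BB'.
  by rewrite -[RHS](mulKmx uB) BB' mulmx1.
rewrite !mulmx_block !(mul0mx, mulmx0, addr0, add0r) mxtrace_block !mxtraceD.
rewrite !mul_scalar_mx -!scalemxAl !mxtraceZ !mul_mx_scalar.
rewrite -!scalemxAl !mxtraceZ mxtrace_scalar mulr1n.
rewrite [\tr (invmx S *m u *m u^T)]mxtrace_mulC mulmxA; by field.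
Qed.

(* With S the square root of P0 and Q diagonalizing the whitened P1, the
   congruence by K = Q^T S^-1 sends P0 to the identity and P1 to a diagonal. *)
Lemma simultaneous_diagonalization n (P0 P1 : 'M[R]_n) : spd P0 -> spd P1 ->
  exists (K : 'M[R]_n) (d : 'rV[R]_n),
  [/\ K \in unitmx, K *m P0 *m K^T = 1%:M,
      K *m P1 *m K^T = diag_mx d & forall i, 0 < d 0 i] /\
  [/\ forall t, K *m P_info P0 P1 t *m K^T = diag_mx (map_mx (@powR R ^~ t) d),
      K *m A_info P0 P1 = 2^-1 *: (diag_mx (map_mx (@ln R) d) *m K) &
      d_info P0 P1 ^+ 2 = \sum_i ln (d 0 i) ^+ 2].
Proof.
move=> spd0 spd1; have [spdS SS] := mxsqrtP _ _ spd0.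
have uS := spd_unitmx _ _ spdS; have [symS _] := spdS.
rewrite /P_info /A_info /d_info.
have spdW : spd (whitened P0 P1).
  rewrite /whitened -[X in _ *m P1 *m X]trmxK trmx_inv symS.
  by apply: spd_congr => //; rewrite unitmx_inv.
have [Q [d [oQ WE d0]]] := spd_diagonalization _ _ spdW.
have uQ := orthogonal_mx_unit _ _ oQ; have oQt := orthogonal_mx_tr _ _ oQ.
rewrite /mxpow /mxlog WE.
set S := mxsqrt P0 in spdS SS uS symS WE *.
exists (Q^T *m invmx S), d.
have KT : (Q^T *m invmx S)^T = invmx S *m Q by rewrite trmx_mul trmxK trmx_inv symS.
rewrite KT; split; split=> //.
- by rewrite unitmx_mul unitmx_tr uQ unitmx_inv.
- by rewrite -SS -!mulmxA mulKmx// mulKVmx.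
- rewrite !mulmxA -2!(mulmxA Q^T) -/(whitened P0 P1) WE.
  by rewrite !mulmxA oQ mul1mx -mulmxA oQ mulmx1.
- move=> t; rewrite spectral_funE// -!mulmxA mulKmx// mulKVmx// !mulmxA.
  by rewrite oQ mul1mx -mulmxA oQ mulmx1.
- rewrite spectral_funE// -scalemxAr -!mulmxA; congr (_ *: _).
  by rewrite mulKmx// (mulmxA Q^T) oQ mul1mx.
rewrite spectral_funE// /frobenius_norm sqr_sqrtr; last first.
  by rewrite sumr_ge0// => i _; rewrite sumr_ge0// => j _; exact: sqr_ge0.
rewrite -mxtrace_mul_tr !trmx_mul trmxK tr_diag_mx !mulmxA mxtrace_mulC.
rewrite !mulmxA oQ mul1mx -(mulmxA _ Q^T) oQ mulmx1 mulmx_diag mxtrace_diag.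
by apply: eq_bigr => i _; rewrite !mxE expr2.
Qed.

End LinAlg.

(** * The energy of a path from the identity to a diagonal matrix *)

Section Core.
Variable R : realType.
Local Notation mu := (@lebesgue_measure R).

(** * Measurability of matrix expressions *)

Lemma measurable_fun_inv d (T : measurableType d) (D : set T) (f : T -> R) :
  measurable_fun D f -> measurable_fun D (fun t => (f t)^-1).
Proof.
move=> mf.
(* Away from zeros this is [1 / x = x / x^2]; at a zero both sides are [0], the default value of the
   inverse. *)
have -> : (fun t => (f t)^-1) = (fun t => f t * expR (- ln (f t ^+ 2))).
  apply/funext => t; have [->|ft0] := eqVneq (f t) 0; first by rewrite invr0 mul0r.
  have ft2 : 0 < f t ^+ 2 by rewrite exprn_even_gt0.
  by rewrite expRN lnK ?posrE//; field.
apply: measurable_funM => //.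
have mln := measurableT_comp (@measurable_ln R) (measurable_funX 2 mf).
exact: (measurableT_comp (@measurable_expR R) (measurable_funN mln)).
Qed.

Definition measurable_mx d (T : measurableType d) (D : set T) m n
    (M : T -> 'M[R]_(m, n)) : Prop :=
  forall i j, measurable_fun D (fun t => M t i j).

Section MeasurableMx.
Context d (T : measurableType d) (D : set T).

Lemma measurable_mx_mul m n p (A : T -> 'M[R]_(m, n)) (B : T -> 'M[R]_(n, p)) :
  measurable_mx d T D _ _ A -> measurable_mx d T D _ _ B ->
  measurable_mx d T D _ _ (fun t => A t *m B t).
Proof.
move=> mA mB i j; under eq_fun do rewrite mxE.
by apply: measurable_sum => k; exact: measurable_funM.
Qed.

Lemma measurable_mx_tr m n (A : T -> 'M[R]_(m, n)) :
  measurable_mx d T D _ _ A -> measurable_mx d T D _ _ (fun t => (A t)^T).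
Proof. by move=> mA i j; under eq_fun do rewrite mxE; exact: mA. Qed.

Lemma measurable_mxtrace n (A : T -> 'M[R]_n) :
  measurable_mx d T D _ _ A -> measurable_fun D (fun t => \tr (A t)).
Proof. by move=> mA; apply: measurable_sum => i; exact: mA. Qed.

Lemma measurable_det n (A : T -> 'M[R]_n) :
  measurable_mx d T D _ _ A -> measurable_fun D (fun t => \det (A t)).
Proof.
move=> mA; apply: measurable_sum => s; apply: measurable_funM => //.
by apply: measurable_prod => i _; exact: mA.
Qed.

Lemma measurable_invmx n (A : T -> 'M[R]_n) :
  measurable_mx d T D _ _ A -> (forall t, D t -> A t \in unitmx) ->
  measurable_mx d T D _ _ (fun t => invmx (A t)).
Proof.
move=> mA uA i j.
apply: (eq_measurable_fun (fun t => (\det (A t))^-1 * cofactor (A t) j i)).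
  by move=> t; rewrite inE => Dt; rewrite /invmx uA// !mxE.
apply: measurable_funM; first by apply: measurable_fun_inv; exact: measurable_det.
apply: measurable_funM => //; apply: measurable_det => k l.
by under eq_fun do rewrite !mxE; exact: mA.
Qed.

Lemma measurable_g_Rao n (P A : T -> 'M[R]_n) :
  measurable_mx d T D _ _ P -> measurable_mx d T D _ _ A ->
  (forall t, D t -> P t \in unitmx) ->
  measurable_fun D (fun t => g_Rao (P t) (A t)).
Proof.
move=> mP mA uP; apply: measurable_mxtrace.
have mPV := measurable_invmx _ _ mP uP.
by do 3![apply: measurable_mx_mul => //].
Qed.

End MeasurableMx.

Lemma measurable_ac_derivative (f g : R -> R) : ac_derivative _ f g ->
  measurable_fun (`[0, 1] : set R) f.
Proof.
move=> [acf _]; apply: subspace_continuous_measurable_fun; first exact: measurable_itv.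
exact: absolutely_continuous_within.
Qed.

Lemma spd_inv_form_ge0 n (S : 'M[R]_n) (u : 'cV[R]_n) : spd S ->
  0 <= \tr (u^T *m invmx S *m u) /\
  (\tr (u^T *m invmx S *m u) = 0 -> u = 0).
Proof.
move=> spdS; have uS := spd_unitmx _ _ _ spdS; have [symS posS] := spdS.
have -> : u^T *m invmx S *m u = (invmx S *m u)^T *m S *m (invmx S *m u).
  by rewrite trmx_mul trmx_inv symS -!mulmxA mulKVmx.
rewrite trace_mx11; have [w0|w0] := eqVneq (invmx S *m u) 0.
  by rewrite w0 mulmx0 mxE; split=> // _; rewrite -(mulKVmx uS u) w0 mulmx0.
have wpos := posS _ w0; split; first exact: ltW.
by move=> w00; move: wpos; rewrite w00 ltxx.
Qed.

(** Congruence by the inverse square root of [P] moves the base point to the identity, where the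
    metric is the squared Frobenius norm of a symmetric matrix. *)
Lemma g_Rao_ge0 n (P D : 'M[R]_n) : spd P -> D^T = D -> 0 <= g_Rao P D.
Proof.
move=> spdP symD; have [spdS SS] := mxsqrtP _ _ _ spdP.
have uS := spd_unitmx _ _ _ spdS; have [symS _] := spdS.
have uK : invmx (mxsqrt P) \in unitmx by rewrite unitmx_inv.
rewrite -(g_Rao_congr _ _ _ _ D uK (spd_unitmx _ _ _ spdP)) trmx_inv symS.
rewrite -{2}SS mulmxA mulVmx// mul1mx mulmxV// /g_Rao invmx1 mul1mx mulmx1.
set M := _ *m D *m _; have MT : M^T = M.
  by rewrite /M !trmx_mul trmx_inv symS symD mulmxA.
by rewrite -{2}MT; exact: mxtrace_mul_tr_ge0.
Qed.

(** This notion is stable under Schur complements ([spd_path_schur]), which is what the induction on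
    the dimension requires. *)
Definition spd_path n (P D : R -> 'M[R]_n) : Prop :=
  [/\ forall t : R, 0 <= t <= 1 -> spd (P t),
      forall i j, ac_derivative _ (fun t => P t i j) (fun t => D t i j),
      forall i j, measurable_fun (`[0, 1] : set R) (fun t => D t i j) &
      forall t : R, 0 <= t <= 1 -> (D t)^T = D t].

Lemma measurable_spd_path_g_Rao n (P D : R -> 'M[R]_n) : spd_path _ P D ->
  measurable_fun (`[0, 1] : set R) (fun t => g_Rao (P t) (D t)).
Proof.
move=> [spdP dP mD _]; apply: measurable_g_Rao => //.
  by move=> i j; exact: measurable_ac_derivative (dP i j).
by move=> t /=; rewrite in_itv/= => /spdP; exact: spd_unitmx.
Qed.

(** * The Schur complement of a path and its velocity *)

Section Schur.
Variables (n : nat) (P D : R -> 'M[R]_(1 + n)).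

Definition schur_slope t : 'cV[R]_n := (P t 0 0)^-1 *: dlsubmx (P t).
Definition schur t : 'M[R]_n :=
  drsubmx (P t) - schur_slope t *m (dlsubmx (P t))^T.
(** Differentiating [b = a c] gives [b' - a' c = a c'], so this is [a c'] wherever the derivatives
    exist. *)
Definition schur_cross t : 'cV[R]_n := dlsubmx (D t) - D t 0 0 *: schur_slope t.
Definition schur_derivative t : 'M[R]_n :=
  drsubmx (D t) - schur_slope t *m (dlsubmx (D t))^T
    - dlsubmx (D t) *m (schur_slope t)^T
    + D t 0 0 *: (schur_slope t *m (schur_slope t)^T).

Hypothesis pathP : spd_path _ P D.

(** The elimination matrix is frozen at time [t] and applied to both [P t] and [D t]. Invariance of
    the metric is pointwise, so the elimination matrix is never differentiated. *)
Lemma schur_congr t : 0 <= t <= 1 ->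
  [/\ 0 < P t 0 0, spd (schur t),
      (schur_derivative t)^T = schur_derivative t &
      g_Rao (P t) (D t) = (D t 0 0 / P t 0 0) ^+ 2 +
        2 / P t 0 0 * \tr ((schur_cross t)^T *m invmx (schur t) *m schur_cross t) +
        g_Rao (schur t) (schur_derivative t)].
Proof.
move=> t01; have [spdP _ _ symD] := pathP.
have [symP _] := spdP t t01.
have uK := elim_mx_unit _ _ (schur_slope t).
have P00 : 0 < P t 0 0.
  have := (spdP t t01).2 (delta_mx 0 0); rewrite trmx_delta -rowE -colE !mxE.
  apply; apply/eqP => /matrixP/(_ 0 0)/eqP; by rewrite !mxE !eqxx oner_eq0.
have cE : P t 0 0 *: schur_slope t = dlsubmx (P t).
  by rewrite scalerA mulfV ?scale1r// gt_eqF.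
have KP : elim_mx _ _ (schur_slope t) *m P t *m (elim_mx _ _ (schur_slope t))^T =
          block_mx (P t 0 0)%:M 0 0 (schur t).
  rewrite {1}(mx11_block_sym _ _ _ symP) elim_mx_congr cE subrr trmx0.
  congr block_mx; rewrite /schur -addrA -[RHS]addr0; congr (_ + _).
  by rewrite scalemxAl cE addrC subrr.
have KD : elim_mx _ _ (schur_slope t) *m D t *m (elim_mx _ _ (schur_slope t))^T =
          block_mx (D t 0 0)%:M (schur_cross t)^T (schur_cross t)
            (schur_derivative t).
  by rewrite {1}(mx11_block_sym _ _ _ (symD t t01)) elim_mx_congr.
have [_ spdS] : 0 < P t 0 0 /\ spd (schur t).
  by apply: spd_block; rewrite -KP; apply: spd_congr => //; exact: spdP.
split=> //.
  rewrite /schur_derivative; move: (schur_slope t) => c.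
  rewrite !raddfD/= !raddfN/= [(_ *: _)^T]linearZ/= !trmx_mul !trmxK.
  by rewrite trmx_drsub symD// [X in X + _]addrAC.
rewrite -(g_Rao_congr _ _ _ _ (D t) uK (spd_unitmx _ _ _ (spdP t t01))) KP KD.
by rewrite g_Rao_block ?gt_eqF//; exact: spd_unitmx.
Qed.

Lemma ac_derivative_inv_corner : ac_derivative _ (fun t => (P t 0 0)^-1)
  (fun t => - (P t 0 0 ^- 2 * D t 0 0)).
Proof.
have [_ dP _ _] := pathP; apply: ac_derivativeV => // t t01.
by have [] := schur_congr t t01.
Qed.

Lemma ac_derivative_slope i : ac_derivative _ (fun t => schur_slope t i 0)
  (fun t => (P t 0 0)^-1 * schur_cross t i 0).
Proof.
have [_ dP _ _] := pathP.
have := ac_derivativeM _ _ _ _ _ ac_derivative_inv_corner (dP (rshift 1 i) (lshift n 0)).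
congr (ac_derivative _ _ _); apply/funext => t; rewrite !mxE//.
by rewrite -exprVn; ring.
Qed.

(** The lower right block of the eliminated velocity is also the derivative of [schur]: insert
    [c' = (b' - a' c) / a] and [b = a c] into the derivative of [C - c b^T]. The last term of
    [schur_congr] is thus the integrand for a path one dimension lower. *)
Lemma spd_path_schur : spd_path _ schur schur_derivative.
Proof.
have [_ dP mD _] := pathP; split.
- by move=> t /schur_congr[].
- move=> i j.
  have d1 := ac_derivativeM _ _ _ _ _ (ac_derivative_slope i)
    (dP (rshift 1 j) (lshift n 0)).
  have d2 := ac_derivativeM _ _ _ _ _ (ac_derivative_cst _ (-1)) d1.
  have := ac_derivativeD _ _ _ _ _ (dP (rshift 1 i) (rshift 1 j)) d2.
  congr (ac_derivative _ _ _); apply/funext => t.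
    by rewrite /schur !mxE big_ord1 !mxE /=; ring.
  by rewrite /schur_derivative /schur_cross !mxE !big_ord1 !mxE /=; ring.
- move=> i j.
  have mc k : measurable_fun (`[0, 1] : set R) (fun t => schur_slope t k 0).
    exact: measurable_ac_derivative (ac_derivative_slope k).
  rewrite (_ : (fun t => schur_derivative t i j) = (fun t =>
    D t (rshift 1 i) (rshift 1 j) - schur_slope t i 0 * D t (rshift 1 j) (lshift n 0)
    - D t (rshift 1 i) (lshift n 0) * schur_slope t j 0
    + D t 0 0 * (schur_slope t i 0 * schur_slope t j 0))).
    apply: measurable_funD; last by do 2?[apply: measurable_funM => //].
    by do 2?[apply: measurable_funB => //]; apply: measurable_funM.
  apply/funext => t; rewrite /schur_derivative.
  move: (schur_slope t) => c.
  by rewrite !mxE !big_ord1 !mxE.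
by move=> t /schur_congr[].
Qed.

Lemma measurable_schur_cross : measurable_mx _ _ (`[0, 1] : set R) _ _ schur_cross.
Proof.
have [_ _ mD _] := pathP; move=> i j; rewrite ord1.
rewrite (_ : (fun t => schur_cross t i 0) = (fun t =>
  D t (rshift 1 i) (lshift n 0) - D t 0 0 * schur_slope t i 0)); last first.
  by apply/funext => t; rewrite /schur_cross; move: (schur_slope t) => c; rewrite !mxE.
apply: measurable_funB => //; apply: measurable_funM => //.
exact: measurable_ac_derivative (ac_derivative_slope i).
Qed.

End Schur.

Lemma diag_mx_corner n (d : 'rV[R]_(1 + n)) :
  diag_mx d = block_mx (d 0 0)%:M 0 0 (diag_mx (rsubmx d)).
Proof.
have dE : d = row_mx (d 0 0)%:M (rsubmx d).
  rewrite -[LHS]hsubmxK; congr row_mx.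
  by rewrite [LHS]mx11_scalar mxE; congr (d _ _)%:M; exact: val_inj.
rewrite {1}dE diag_mx_row; congr block_mx.
by apply/matrixP => i j; rewrite !ord1 !mxE.
Qed.

Lemma schur_diag n (P : R -> 'M[R]_(1 + n)) t (d : 'rV[R]_(1 + n)) :
  P t = diag_mx d -> schur _ P t = diag_mx (rsubmx d).
Proof.
move=> Pd; have dl0 : dlsubmx (P t) = 0.
  by apply/matrixP => i j; rewrite Pd !mxE (eq_rlshift _ _).
rewrite /schur dl0 trmx0 mulmx0 subr0 Pd.
by apply/matrixP => i j; rewrite !mxE (inj_eq (@rshift_inj _ _)).
Qed.

(** The finite total rules out infinite terms, so the lower bounds can be cancelled over the
    reals. *)
Lemma lee_add3_eq (x y z : \bar R) (r s : R) :
  (r%:E <= x -> 0 <= y -> s%:E <= z -> x + y + z <= (r + s)%:E ->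
  [/\ x <= r%:E, y <= 0 & z <= s%:E])%E.
Proof.
move: x y z => [x||] [y||] [z||]//; rewrite ?lee_fin.
move=> rx y0 sz le; split; lra.
Qed.

(** Bound and equality case share one induction: the equality case for [P] needs the bound for the
    Schur complement, to force equality there, and then its equality case. *)
Lemma energy_diag n (P D : R -> 'M[R]_n) (d : 'rV[R]_n) : spd_path _ P D ->
  P 0 = 1%:M -> P 1 = diag_mx d ->
  ((\sum_i ln (d 0 i) ^+ 2)%:E <=
     \int[mu]_(t in `[0%R, 1%R]) (g_Rao (P t) (D t))%:E)%E /\
  ((\int[mu]_(t in `[0%R, 1%R]) (g_Rao (P t) (D t))%:E <=
     (\sum_i ln (d 0 i) ^+ 2)%:E)%E ->
   forall t : R, 0 <= t <= 1 -> P t = diag_mx (map_mx (@powR R ^~ t) d)).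
Proof.
elim: n P D d => [|n IHn] P D d pathP P0 P1.
  split=> [|_ t _]; last by apply/matrixP => -[].
  rewrite big_ord0; apply: integral_ge0 => t _; rewrite lee_fin.
  by rewrite /g_Rao /mxtrace big_ord0.
have [spdP dP mD symD] := pathP.
have t0 : 0 <= (0 : R) <= 1 by rewrite lexx ler01.
have t1 : 0 <= (1 : R) <= 1 by rewrite lexx ler01.
have d_gt0 : forall i, 0 < d 0 i by apply: spd_diag_gt0; rewrite -P1; exact: spdP.
have P0' : P 0 = diag_mx (const_mx 1) by rewrite P0 diag_const_mx.
have pathS := spd_path_schur n P D pathP.
have S0 : schur n P 0 = 1%:M.
  rewrite (schur_diag _ _ _ _ P0') -diag_const_mx.
  by congr diag_mx; apply/rowP => i; rewrite !mxE.
have [IH1 IH2] := IHn _ _ _ pathS S0 (schur_diag _ _ _ _ P1).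
have Pin t : 0 <= t <= 1 -> 0 < P t 0 0 by case/(schur_congr n P D pathP).
have [acl dl] := ac_derivative_ln _ _ _ (dP 0 0) Pin.
have ma : measurable_fun (`[0, 1] : set R) (fun t => (P t 0 0)^-1).
  exact: measurable_ac_derivative (ac_derivative_inv_corner n P D pathP).
have ml : measurable_fun (`[0, 1] : set R) (fun t => D t 0 0 / P t 0 0).
  exact: measurable_funM.
have lnP0 : ln (P 0 0 0) = 0 by rewrite P0 !mxE eqxx ln1.
have lnP1 : ln (P 1 0 0) = ln (d 0 0) by rewrite P1 !mxE eqxx.
have E1 := energy_lower_bound _ _ _ acl ml dl.
have E1' := energy_lower_bound_eq _ _ _ acl ml dl.
rewrite lnP0 lnP1 subr0 in E1 E1'.
have sumE : \sum_i ln (d 0 i) ^+ 2 =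
    ln (d 0 0) ^+ 2 + \sum_i ln ((rsubmx (d : 'rV[R]_(1 + n))) 0 i) ^+ 2.
  rewrite big_ord_recl; congr (_ + _); apply: eq_bigr => i _.
  by rewrite mxE; congr (ln (d 0 _) ^+ 2); exact: val_inj.
pose cross t := 2 / P t 0 0 * \tr ((schur_cross n P D t)^T *m
  invmx (schur n P t) *m schur_cross n P D t).
have cross_ge0 t : 0 <= t <= 1 -> 0 <= cross t.
  move=> t01; have [Pt spdS _ _] := schur_congr n P D pathP t t01.
  by rewrite mulr_ge0 ?divr_ge0 ?(ltW Pt)// (spd_inv_form_ge0 _ _ _ spdS).1.
have mcross : measurable_fun (`[0, 1] : set R) cross.
  have [spdS dS _ _] := pathS.
  apply: measurable_funM; first by apply: measurable_funM.
  have mcr := measurable_schur_cross n P D pathP.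
  apply: measurable_mxtrace; apply: measurable_mx_mul => //.
  apply: measurable_mx_mul; first exact: measurable_mx_tr.
  apply: measurable_invmx.
    by move=> i j; exact: measurable_ac_derivative (dS i j).
  by move=> t /=; rewrite in_itv/= => /spdS; exact: spd_unitmx.
have mgS := measurable_spd_path_g_Rao _ _ _ pathS.
have gS_ge0 t : 0 <= t <= 1 ->
    0 <= g_Rao (schur n P t) (schur_derivative n P D t).
  by case/(schur_congr n P D pathP) => _ spdS symT _; exact: g_Rao_ge0.
have -> : (\int[mu]_(t in `[0%R, 1%R]) (g_Rao (P t) (D t))%:E =
  \int[mu]_(t in `[0%R, 1%R]) ((D t 0 0 / P t 0 0) ^+ 2)%:E +
  \int[mu]_(t in `[0%R, 1%R]) (cross t)%:E +
  \int[mu]_(t in `[0%R, 1%R])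
     (g_Rao (schur n P t) (schur_derivative n P D t))%:E)%E.
  have mI := measurable_unit_itv R.
  have m1 : measurable_fun (`[0, 1] : set R) (fun t => ((D t 0 0 / P t 0 0) ^+ 2)%:E).
    by apply/measurable_EFinP; exact: measurable_funX.
  have m2 : measurable_fun (`[0, 1] : set R) (fun t => (cross t)%:E).
    exact/measurable_EFinP.
  have m3 : measurable_fun (`[0, 1] : set R) (fun t =>
      (g_Rao (schur n P t) (schur_derivative n P D t))%:E).
    exact/measurable_EFinP.
  have h1 t : (`[0, 1]%classic : set R) t -> (0 <= ((D t 0 0 / P t 0 0) ^+ 2)%:E)%E.
    by rewrite lee_fin sqr_ge0.
  have h2 t : (`[0, 1]%classic : set R) t -> (0 <= (cross t)%:E)%E.
    by rewrite /= in_itv/= lee_fin; exact: cross_ge0.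
  have h3 t : (`[0, 1]%classic : set R) t ->
      (0 <= (g_Rao (schur n P t) (schur_derivative n P D t))%:E)%E.
    by rewrite /= in_itv/= lee_fin; exact: gS_ge0.
  rewrite -(ge0_integralD mu mI h1 m1 h2 m2) -(ge0_integralD mu mI _ _ h3 m3).
  - apply: eq_integral => t; rewrite inE/= in_itv/= => t01.
    by have [_ _ _ ->] := schur_congr n P D pathP t t01; rewrite !EFinD.
  - by move=> t It; rewrite adde_ge0 ?h1 ?h2.
  - exact: emeasurable_funD.
have E2 : (0 <= \int[mu]_(t in `[0%R, 1%R]) (cross t)%:E)%E.
  by apply: integral_ge0 => t /=; rewrite in_itv/= lee_fin; exact: cross_ge0.
rewrite sumE; split.
  rewrite EFinD; apply: leeD IH1; apply: (le_trans E1).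
  by rewrite leeDl.
move=> /(lee_add3_eq _ _ _ _ _ E1 E2 IH1)[/E1' lnP crossle /IH2 SE] t t01.
have Pt := Pin t t01.
have cross0 : (\int[mu]_(s in `[0%R, 1%R]) `|(cross s)%:E| = 0)%E.
  apply/eqP; rewrite eq_le integral_ge0 ?andbT//.
  apply: le_trans crossle; rewrite le_eqVlt; apply/orP; left; apply/eqP.
  apply: eq_integral => s; rewrite inE/= in_itv/= => s01.
  by rewrite ger0_norm// cross_ge0.
have mcross' : measurable_fun (`[0, 1] : set R) (fun t => (cross t)%:E).
  exact/measurable_EFinP.
have [/(_ cross0) {}cross0 _] := ae_eq_integral_abs mu (measurable_unit_itv R) mcross'.
have slope0 i : schur_slope n P t i 0 = 0.
  have [acs ds] := ac_derivative_slope n P D pathP i.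
  rewrite (absolutely_continuous_affine _ _ 0 acs _ t t01); last first.
    apply: (filterS2 (ae_filter_ringOfSetsType mu) _ ds cross0) => s dss cs s01.
    have := dss s01; rewrite (_ : schur_cross n P D s = 0) ?mxE ?mulr0//.
    have [Ps spdS _ _] := schur_congr n P D pathP s s01.
    apply: (spd_inv_form_ge0 _ _ _ spdS).2.
    have /eqP : (cross s)%:E = 0%:E by apply: cs; rewrite /= in_itv.
    rewrite eqe mulf_eq0 => /orP[|/eqP //].
    by rewrite gt_eqF ?divr_gt0.
  rewrite mulr0 addr0 /schur_slope P0 !mxE.
  by rewrite -val_eqE mulr0.
have cE : schur_slope n P t = 0 by apply/colP => i; rewrite slope0 mxE.
have dl0 : dlsubmx (P t : 'M[R]_(1 + n)) = 0.
  have /eqP := cE; rewrite /schur_slope scaler_eq0 invr_eq0 gt_eqF//=.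
  by move=> /eqP.
have [symP _] := spdP t t01.
rewrite [LHS](mx11_block_sym _ _ (P t : 'M[R]_(1 + n)) symP) dl0 trmx0.
have -> : drsubmx (P t : 'M[R]_(1 + n)) = schur n P t.
  by rewrite /schur cE mul0mx subr0.
rewrite SE//.
(* The logarithm of the corner is affine from [0] to [ln (d 0 0)], and a real power is the
   exponential of [t] times the logarithm. *)
have -> : (P t 0 0) = powR (d 0 0) t.
  by rewrite /powR gt_eqF// -[LHS]lnK ?posrE// lnP// add0r.
rewrite [RHS](diag_mx_corner n (map_mx (@powR R ^~ t) d)) mxE.
by rewrite map_rsubmx.
Qed.

End Core.

(** * Feasible paths and the geodesic *)

Section Paths.
Variable R : realType.
Local Notation mu := (@lebesgue_measure R).

(** * Entrywise calculus for matrix paths *)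

Lemma mx_entry_le_norm m n (M : 'M[R]_(m, n)) i j : `|M i j| <= `|M|.
Proof.
rewrite [leRHS]/Num.Def.normr/= mx_normrE.
by apply: le_trans (le_bigmax _ _ (i, j)).
Qed.

Lemma absolutely_continuous_entry m n (P : R -> 'M[R]_(m, n)) i j :
  absolutely_continuous 0 1 P -> absolutely_continuous 0 1 (fun t => P t i j).
Proof.
move=> acP; apply: (absolutely_continuous_le _ _ _ _ _ _ 1 _ _ _ _ acP acP) => //.
move=> u v _ _ _; rewrite mul1r -[leLHS]addr0; apply: lerD => //.
by have := mx_entry_le_norm _ _ (P v - P u) i j; rewrite !mxE.
Qed.

Lemma absolutely_continuousZ (V : normedModType R) (f : R -> R) (v : V) :
  absolutely_continuous 0 1 f -> absolutely_continuous 0 1 (fun t => f t *: v).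
Proof.
move=> acf.
apply: (absolutely_continuous_le _ _ _ _ _ _ `|v| _ _ _ _ acf acf) => //.
move=> s t _ _ _; rewrite -scalerBl normrZ mulrC ler_wpM2l//.
by rewrite lerDl.
Qed.

Lemma absolutely_continuous_sum (V : normedModType R) (I : Type) (r : seq I)
    (f : I -> R -> V) : (forall i, absolutely_continuous 0 1 (f i)) ->
  absolutely_continuous 0 1 (fun t => \sum_(i <- r) f i t).
Proof.
move=> acf; elim: r => [|i r IHr].
  apply: (absolutely_continuous_lipschitz _ _ _ _ 0) => // u v _ _ _.
  by rewrite !big_nil subrr normr0 mul0r.
apply: (absolutely_continuous_le _ _ _ _ _ _ 1 _ _ _ _ (acf i) IHr) => //.
move=> u v _ _ _; rewrite !big_cons mul1r opprD addrACA; exact: ler_normD.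
Qed.

Lemma absolutely_continuous_mx m n (P : R -> 'M[R]_(m, n)) :
  (forall i j, absolutely_continuous 0 1 (fun t => P t i j)) ->
  absolutely_continuous 0 1 P.
Proof.
move=> acP; have -> : P = fun t => \sum_i \sum_j P t i j *: delta_mx i j.
  by apply/funext => t; exact: matrix_sum_delta.
apply: absolutely_continuous_sum => i; apply: absolutely_continuous_sum => j.
exact: absolutely_continuousZ.
Qed.

Lemma is_derive_mxP m n (P : R -> 'M[R]_(m, n)) (t : R) (D : 'M[R]_(m, n)) :
  is_derive t 1 P D <-> forall i j, is_derive t 1 (fun s => P s i j) (D i j).
Proof.
split=> [[dP <-] i j|dP].
  rewrite (derive_mx dP) mxE; apply: derivableP.
  exact: (derivable_mxP P t 1).1.
have derP : derivable P t 1.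
  by apply/derivable_mxP => i j; have [] := dP i j.
split=> //; rewrite (derive_mx derP); apply/matrixP => i j; rewrite mxE.
by have [] := dP i j.
Qed.

Definition ac_derivative_mx m n (P D : R -> 'M[R]_(m, n)) : Prop :=
  forall i j, ac_derivative _ (fun t => P t i j) (fun t => D t i j).

Lemma ac_derivative_mxP m n (P D : R -> 'M[R]_(m, n)) :
  ac_derivative_mx _ _ P D <-> absolutely_continuous 0 1 P /\
    {ae mu, forall t : R, 0 <= t <= 1 -> is_derive t 1 P (D t)}.
Proof.
have aeF := ae_filter_ringOfSetsType mu.
split=> [dP|[acP dP] i j].
  split; first by apply: absolutely_continuous_mx => i j; have [] := dP i j.
  (* There are finitely many entries, so one null set serves them all. *)
  have dPt : {ae mu, forall (t : R), forall ij : 'I_m * 'I_n,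
      0 <= t <= 1 -> is_derive t 1 (fun s => P s ij.1 ij.2) (D t ij.1 ij.2)}.
    by apply: filter_forall => -[i j]; have [] := dP i j.
  apply: filterS dPt => t dPt t01; apply/is_derive_mxP => i j.
  exact: (dPt (i, j) t01).
split; first exact: absolutely_continuous_entry.
by apply: filterS dP => t dPt t01; have /is_derive_mxP := dPt t01.
Qed.

Lemma ac_derivative_mxMl m n p (K : 'M[R]_(m, n)) (P D : R -> 'M[R]_(n, p)) :
  ac_derivative_mx _ _ P D ->
  ac_derivative_mx _ _ (fun t => K *m P t) (fun t => K *m D t).
Proof.
move=> dP i j; under eq_fun do rewrite mxE.
under [X in ac_derivative _ _ X]eq_fun do rewrite mxE.
apply: ac_derivative_sum => k.
have := ac_derivativeM _ _ _ _ _ (ac_derivative_cst _ (K i k)) (dP k j).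
by congr (ac_derivative _ _ _); apply/funext => t /=; rewrite mul0r add0r.
Qed.

Lemma ac_derivative_mx_tr m n (P D : R -> 'M[R]_(m, n)) :
  ac_derivative_mx _ _ P D ->
  ac_derivative_mx _ _ (fun t => (P t)^T) (fun t => (D t)^T).
Proof.
move=> dP i j; have := dP j i.
by congr (ac_derivative _ _ _); apply/funext => t; rewrite mxE.
Qed.

Lemma ac_derivative_mx_congr m n (K : 'M[R]_(m, n)) (P D : R -> 'M[R]_n) :
  ac_derivative_mx _ _ P D ->
  ac_derivative_mx _ _ (fun t => K *m P t *m K^T) (fun t => K *m D t *m K^T).
Proof.
move=> /(ac_derivative_mxMl _ _ _ K)/ac_derivative_mx_tr.
move=> /(ac_derivative_mxMl _ _ _ K)/ac_derivative_mx_tr dP i j.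
have := dP i j; congr (ac_derivative _ _ _); apply/funext => t.
  by rewrite !trmx_mul !trmxK.
by rewrite !trmx_mul !trmxK.
Qed.

Lemma ac_derivative_expR (l : R) :
  ac_derivative _ (fun t => expR (t * l)) (fun t => l * expR (t * l)).
Proof.
(* From [1 + z <= expR z] at [z = b - a]. On the unit interval [expR (s * l)] is at most [expR |l|],
   whence the Lipschitz constant below. *)
have expR_sub (a b : R) : expR a - expR b <= expR a * `|a - b|.
  have -> : expR a - expR b = expR a * (1 - expR (b - a)).
    by rewrite mulrBr mulr1 -expRD [a + _]addrC subrK.
  rewrite ler_wpM2l ?expR_ge0// (le_trans _ (ler_norm _))//.
  by have := expR_ge1Dx (b - a); lra.
split.
  apply: (absolutely_continuous_lipschitz _ _ _ _ (expR `|l| * `|l|)).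
    by rewrite mulr_ge0 ?expR_ge0.
  move=> u v u0 uv v1.
  have expR_le s : 0 <= s -> s <= 1 -> expR (s * l) <= expR `|l|.
    move=> s0 s1; rewrite ler_expR (le_trans (ler_norm _))// normrM ger0_norm//.
    by rewrite -[leRHS]mul1r ler_wpM2r.
  have h a b : expR a <= expR `|l| -> `|a - b| = `|l| * (v - u) ->
      expR a - expR b <= expR `|l| * `|l| * (v - u).
    move=> ale ab; apply: le_trans (expR_sub a b) _.
    by rewrite ab -mulrA ler_wpM2r// mulr_ge0// subr_ge0.
  have vl : `|v * l - u * l| = `|l| * (v - u).
    by rewrite -mulrBl normrM ger0_norm ?subr_ge0// mulrC.
  rewrite ler_norml lerNl opprB.
  apply/andP; split; apply: h => //; [|by rewrite distrC|]; apply: expR_le; lra.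
apply: aeW => t _; rewrite mulrC.
apply: (@is_derive1_comp _ expR (fun t => t * l)).
have := is_deriveM (is_derive_id t 1) (is_derive_cst l t 1).
by rewrite scaler0 add0r /GRing.scale/= mulr1.
Qed.

(** * Feasible paths under congruence *)

Lemma feasible_spd_path n (P0 P1 K : 'M[R]_n) (P A : R -> 'M[R]_n) :
  feasible P0 P1 P A -> K \in unitmx ->
  spd_path _ _ (fun t => K *m P t *m K^T)
    (fun t => K *m (A t *m P t + P t *m (A t)^T) *m K^T).
Proof.
move=> [spdP _ acP mA dP] uK.
have acdP : ac_derivative_mx _ _ P (fun t => A t *m P t + P t *m (A t)^T).
  by apply/ac_derivative_mxP.
have mP : measurable_mx _ _ _ (`[0, 1] : set R) _ _ P.
  by move=> i j; exact: measurable_ac_derivative (acdP i j).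
split.
- by move=> t /spdP; exact: spd_congr.
- exact: ac_derivative_mx_congr.
- have mcst (M : 'M[R]_n) : measurable_mx _ _ _ (`[0, 1] : set R) _ _ (cst M).
    by move=> i j; exact: measurable_cst.
  apply: measurable_mx_mul; last exact: mcst.
  apply: measurable_mx_mul; [exact: mcst|move=> i j].
  rewrite (_ : (fun t => _) = (fun t => (A t *m P t) i j + (P t *m (A t)^T) i j)).
    apply: measurable_funD; apply: measurable_mx_mul => //.
    exact: measurable_mx_tr.
  by apply/funext => t; rewrite mxE.
move=> t /spdP[symP _].
by rewrite !trmx_mul trmxK raddfD/= !trmx_mul !trmxK symP addrC mulmxA.
Qed.

Lemma cost_congr n (P0 P1 K : 'M[R]_n) (P A : R -> 'M[R]_n) :
  feasible P0 P1 P A -> K \in unitmx ->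
  cost P A = (\int[mu]_(t in `[0%R, 1%R]) (g_Rao (K *m P t *m K^T)
    (K *m (A t *m P t + P t *m (A t)^T) *m K^T))%:E)%E.
Proof.
move=> [spdP _ _ _ _] uK; apply: eq_integral => t.
rewrite inE/= in_itv/= => /spdP spdPt.
by rewrite g_Rao_congr//; exact: spd_unitmx.
Qed.

Lemma ac_derivative_diag_powR n (d : 'rV[R]_n) : (forall i, 0 < d 0 i) ->
  ac_derivative_mx _ _ (fun t => diag_mx (map_mx (@powR R ^~ t) d))
    (fun t => diag_mx (map_mx (@ln R) d) *m diag_mx (map_mx (@powR R ^~ t) d)).
Proof.
move=> d0 i j; have [->|ij] := eqVneq i j.
  have := ac_derivative_expR (ln (d 0 j)).
  congr (ac_derivative _ _ _); apply/funext => t;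
    by rewrite ?mul_diag_mx !mxE eqxx mulr1n /powR gt_eqF.
have := ac_derivative_cst R 0; congr (ac_derivative _ _ _); apply/funext => t;
  by rewrite ?mul_diag_mx !mxE (negbTE ij) ?mulr0.
Qed.

(** * The geodesic in diagonalizing coordinates *)

Section Geodesic.
Variables (n : nat) (P0 P1 K : 'M[R]_n) (d : 'rV[R]_n).
Hypotheses (uK : K \in unitmx) (KP0 : K *m P0 *m K^T = 1%:M)
  (KP1 : K *m P1 *m K^T = diag_mx d) (d0 : forall i, 0 < d 0 i).
Hypothesis (KP : forall t,
  K *m P_info P0 P1 t *m K^T = diag_mx (map_mx (@powR R ^~ t) d)).
Hypothesis (KA : K *m A_info P0 P1 = 2^-1 *: (diag_mx (map_mx (@ln R) d) *m K)).

Lemma congr_inj (X Y : 'M[R]_n) : K *m X *m K^T = K *m Y *m K^T -> X = Y.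
Proof.
move=> XY; rewrite -(mulKmx uK X) -(mulKmx uK Y); congr (_ *m _).
have uKT : K^T \in unitmx by rewrite unitmx_tr.
by rewrite -(mulmxK uKT (K *m X)) XY mulmxK.
Qed.

(** In these coordinates [A_info] acts as half of [diag (ln d)], which commutes with the diagonal
    path, so the two summands of the velocity are equal halves. *)
Lemma P_info_velocity t :
  K *m (A_info P0 P1 *m P_info P0 P1 t + P_info P0 P1 t *m (A_info P0 P1)^T) *m K^T =
  diag_mx (map_mx (@ln R) d) *m diag_mx (map_mx (@powR R ^~ t) d).
Proof.
move: KA (KP t); generalize (A_info P0 P1) (P_info P0 P1 t) => A P eA eP.
rewrite mulmxDr mulmxDl !mulmxA eA -(mulmxA (K *m P) _ K^T).
rewrite -trmx_mul eA linearZ/= trmx_mul tr_diag_mx -!scalemxAl -scalemxAr.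
rewrite (mulmxA (K *m P)) eP -2!(mulmxA (diag_mx (map_mx (@ln R) d))).
rewrite eP [X in _ + _ *: X]diag_mxC -scalerDl.
by rewrite [X in X *: _](_ : _ = 1) ?scale1r//; field.
Qed.

Lemma P_info_feasible : feasible P0 P1 (P_info P0 P1) (fun _ => A_info P0 P1).
Proof.
pose L : R -> 'M[R]_n := fun t =>
  diag_mx (map_mx (@ln R) d) *m diag_mx (map_mx (@powR R ^~ t) d).
have PE t : P_info P0 P1 t =
    invmx K *m diag_mx (map_mx (@powR R ^~ t) d) *m (invmx K)^T.
  apply: congr_inj; rewrite KP trmx_inv !mulmxA mulmxV// mul1mx -mulmxA.
  by rewrite mulVmx ?unitmx_tr// mulmx1.
have acdP : ac_derivative_mx _ _ (P_info P0 P1)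
    (fun t => A_info P0 P1 *m P_info P0 P1 t + P_info P0 P1 t *m (A_info P0 P1)^T).
  move=> i j; have := ac_derivative_mx_congr _ _ (invmx K) _ _
    (ac_derivative_diag_powR _ d d0) i j.
  congr (ac_derivative _ _ _); apply/funext => t; first by rewrite PE.
  congr (fun_of_matrix _ i j); apply: congr_inj.
  rewrite P_info_velocity trmx_inv !mulmxA mulmxV// mul1mx -mulmxA.
  by rewrite mulVmx ?unitmx_tr// mulmx1.
have [acP dP] := (ac_derivative_mxP _ _ _ _).1 acdP.
split => //.
- move=> t _; rewrite PE; apply: spd_congr; first by rewrite unitmx_inv.
  by apply: spd_diag => i; rewrite mxE powR_gt0.
- split; apply: congr_inj; rewrite KP ?KP0 ?KP1.
    rewrite -diag_const_mx; congr diag_mx; apply/rowP => i.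
    by rewrite !mxE powRr0.
  by congr diag_mx; apply/rowP => i; rewrite mxE powRr1// ltW.
Qed.

(** The geodesic has constant speed: the powers of [d] cancel in the metric and leave the trace of
    the square of [diag (ln d)]. *)
Lemma P_info_cost :
  cost (P_info P0 P1) (fun _ => A_info P0 P1) = (\sum_i ln (d 0 i) ^+ 2)%:E.
Proof.
rewrite (cost_congr _ _ _ _ _ _ P_info_feasible uK).
have -> : (fun t => (g_Rao (K *m P_info P0 P1 t *m K^T)
    (K *m (A_info P0 P1 *m P_info P0 P1 t +
      P_info P0 P1 t *m (A_info P0 P1)^T) *m K^T))%:E) =
    cst (\sum_i ln (d 0 i) ^+ 2)%:E.
  apply/funext => t; rewrite P_info_velocity KP /g_Rao.
  have uD : diag_mx (map_mx (@powR R ^~ t) d) \in unitmx.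
    by apply/spd_unitmx/spd_diag => i; rewrite mxE powR_gt0.
  rewrite diag_mxC mulKmx// -mulmxA mulKmx// mulmx_diag mxtrace_diag.
  by congr EFin; apply: eq_bigr => i _; rewrite !mxE expr2.
rewrite integral_cst; last exact: measurable_unit_itv.
by rewrite [X in (_ * X)%E]lebesgue_measure_unit_itv mule1.
Qed.

Lemma cost_lower_bound (P A : R -> 'M[R]_n) : feasible P0 P1 P A ->
  ((\sum_i ln (d 0 i) ^+ 2)%:E <= cost P A)%E /\
  ((cost P A <= (\sum_i ln (d 0 i) ^+ 2)%:E)%E ->
   forall t : R, 0 <= t <= 1 -> P t = P_info P0 P1 t).
Proof.
move=> fPA; rewrite (cost_congr _ _ _ _ _ _ fPA uK).
have [_ [PP0 PP1] _ _ _] := fPA.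
have [||h1 h2] := energy_diag _ _ _ _ d (feasible_spd_path _ _ _ _ _ _ fPA uK).
- by rewrite PP0.
- by rewrite PP1.
by split=> // /h2 h t t01; apply: congr_inj; rewrite KP h.
Qed.

End Geodesic.

(** Both sides are the derivative of the common path. This turns uniqueness of the path into what
    can be asserted about the optimal [A]. *)
Lemma feasible_velocity_unique n (P0 P1 : 'M[R]_n) (P A P' A' : R -> 'M[R]_n) :
  feasible P0 P1 P A -> feasible P0 P1 P' A' ->
  (forall t : R, 0 <= t <= 1 -> P t = P' t) ->
  {ae mu, forall t : R, 0 <= t <= 1 ->
    A t *m P t + P t *m (A t)^T = A' t *m P t + P t *m (A' t)^T}.
Proof.
move=> [_ _ _ _ dP] [_ _ _ _ dP'] PP'.
(* The paths agree only on the closed unit interval, so their two-sided derivatives can be compared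
   only at interior points; the endpoints form a null set. *)
have ends : {ae mu, forall t : R, t != 0 /\ t != 1}.
  exists [set 0; 1]; split.
  - by apply: measurableU; exact: measurable_set1.
  - by apply: countable_lebesgue_measure0; apply: finite_set_countable; exact: finite_set2.
  move=> t /=; apply: contra_notP => /not_orP[t0 t1].
  by split; apply/eqP.
apply: (filterS3 (ae_filter_ringOfSetsType mu) _ dP dP' ends).
move=> t dPt dPt' [t0 t1] /andP[t_ge0 t_le1].
have t01 : 0 <= t <= 1 by rewrite t_ge0.
have tin : t \in `]0, 1[.
  by rewrite in_itv/= lt_neqAle eq_sym t0 t_ge0 lt_neqAle t1.
have nearPP' : \near t, P t = P' t.
  near=> s; apply: PP'.
  have : s \in `]0, 1[ by near: s; exact: near_in_itvoo.
  by rewrite in_itv/= => /andP[/ltW -> /ltW ->].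
have [_ <-] := near_eq_is_derive nearPP' (dPt t01).
by have [_ ->] := dPt' t01; rewrite PP'.
Unshelve. all: by end_near. Qed.

End Paths.

Theorem proposition2 (R : realType) (n : nat) (P0 P1 : 'M[R]_n)
    (hP0 : spd P0) (hP1 : spd P1) :
  [/\ minimizer P0 P1 (P_info P0 P1) (fun _ : R => A_info P0 P1),
      forall P A : R -> 'M[R]_n, minimizer P0 P1 P A ->
        forall t : R, 0 <= t <= 1 -> P t = P_info P0 P1 t,
      forall P A : R -> 'M[R]_n, minimizer P0 P1 P A ->
        {ae @lebesgue_measure R, forall t : R, 0 <= t <= 1 ->
          A t *m P t + P t *m (A t)^T =
          A_info P0 P1 *m P t + P t *m (A_info P0 P1)^T} &
      optimal_value P0 P1 = ((d_info P0 P1) ^+ 2)%:E].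
Proof.
have [K [d [[uK KP0 KP1 d0] [KP KA dE]]]] :=
  simultaneous_diagonalization _ _ _ _ hP0 hP1.
have feas := P_info_feasible _ _ _ _ _ _ uK KP0 KP1 d0 KP KA.
have costE := P_info_cost _ _ _ _ _ _ uK KP0 KP1 d0 KP KA.
have bound := cost_lower_bound _ _ _ _ _ _ uK KP0 KP1 KP.
have min_info : minimizer P0 P1 (P_info P0 P1) (fun=> A_info P0 P1).
  by split=> // P A /bound[h _]; rewrite costE.
have uniq P A : minimizer P0 P1 P A ->
    forall t : R, 0 <= t <= 1 -> P t = P_info P0 P1 t.
  (* Compared with the geodesic, a minimizer costs no more than the lower bound, which is the
     equality case. *)
  move=> [fPA minPA]; apply: (bound P A fPA).2.
  by rewrite -costE; exact: minPA.
split=> //.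
  move=> P A minPA; have [fPA _] := minPA.
  exact: (feasible_velocity_unique _ _ _ _ _ _ _ _ fPA feas (uniq _ _ minPA)).
rewrite dE; apply/eqP; rewrite eq_le; apply/andP; split.
  by apply: ereal_inf_lbound; exists (P_info P0 P1), (fun=> A_info P0 P1).
by apply/ereal_infP => _ [P [A [/bound[h _] ->]]].
Qed.
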